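(* Let $\mathfrak{n}\in A_+$ be of the form $\mathfrak{n}=\mathfrak{p}^r$ with $\mathfrak{p}$ a prime and $r\ge 1$, or $\mathfrak{n}=\mathfrak{p}\mathfrak{q}$ with $\mathfrak{p},\mathfrak{q}$ distinct primes. For a family $\underline{r}=(r_{\mathfrak{a}})$ of integers indexed by the monic divisors $\mathfrak{a}$ of $\mathfrak{n}$, let $g_{\underline{r}}(z):=\prod_{\mathfrak{a}\mid\mathfrak{n},\,\mathfrak{a}\in A_+}\Delta(\mathfrak{a}z)^{r_{\mathfrak{a}}}$. If $k$ is a positive integer such that $g_{\underline{r}}$ has a $k$-th root which is a modular function on $X_0(\mathfrak{n})$, then $\frac{r_{\mathfrak{a}}}{k}\in\frac{1}{(q-1)(q^2-1)}\mathbb{Z}$ for every monic $\mathfrak{a}\mid\mathfrak{n}$. In particular, if $\gcd(r_{\mathfrak{a}}:\mathfrak{a}\mid\mathfrak{n}\text{ monic})=1$, then $k\mid (q-1)(q^2-1)$.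
   Context: $\mathbb{F}_q$ is a finite field with $q$ elements, $A=\mathbb{F}_q[T]$, $K=\mathbb{F}_q(T)$, $A_+$ is the set of monic polynomials in $A$, and a prime means a monic irreducible polynomial. $\mathbb{C}_\infty$ is the completion of an algebraic closure of $K_\infty=\mathbb{F}_q((1/T))$ and $\Omega=\mathbb{C}_\infty-K_\infty$. $\Gamma_0(\mathfrak{n})$ is the group of matrices in $\operatorname{GL}_2(A)$ whose lower-left entry is divisible by $\mathfrak{n}$, acting by linear fractional transformations; $X_0(\mathfrak{n})$ is the Drinfeld modular curve with $\mathbb{C}_\infty$-points $\Gamma_0(\mathfrak{n})\backslash(\Omega\cup\mathbb{P}^1(K))$. A modular function on $X_0(\mathfrak{n})$ is a rigid-analytic meromorphic function on $\Omega$ (meromorphic at the cusps) invariant under $\Gamma_0(\mathfrak{n})$; ''$g$ has a $k$-th root which is a modular function'' means there is such an $f$ with $f^k=g$. $\Delta$ is the Drinfeld discriminant function (as normalized by Gekeler), a nowhere-vanishing holomorphic Drinfeld modular form on $\Omega$ of weight $q^2-1$ and type $0$ for $\operatorname{GL}_2(A)$. *)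

(* Defs.v *)
From HB Require Import structures.
From mathcomp Require Import all_boot all_order all_algebra.
From mathcomp Require Import boolp classical_sets reals.

Set Implicit Arguments.
Unset Strict Implicit.
Unset Printing Implicit Defensive.

Import Order.TTheory GRing.Theory Num.Theory.
Local Open Scope ring_scope.
Local Open Scope classical_set_scope.

Section ValuedField.
Variables (R : realType) (C : fieldType) (abs : C -> R).

Definition is_ultrametric_abs : Prop :=
  [/\ forall x, 0 <= abs x,
      forall x, abs x = 0 <-> x = 0,
      forall x y, abs (x * y) = abs x * abs y
    & forall x y, abs (x + y) <= Num.max (abs x) (abs y)].

Definition vcvg (u : nat -> C) (l : C) : Prop :=
  forall eps : R, 0 < eps ->
    exists N : nat, forall n, (N <= n)%N -> abs (u n - l) < eps.

Definition vcauchy (u : nat -> C) : Prop :=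
  forall eps : R, 0 < eps ->
    exists N : nat, forall m n, (N <= m)%N -> (N <= n)%N ->
      abs (u m - u n) < eps.

(* The limit of u; 0 if u diverges. *)
Definition vlim (u : nat -> C) : C := xget 0 [set l | vcvg u l].

(* Uniform limits on U of rational functions without poles on U.  For an
   affinoid subset U of the projective line these are the rigid-analytic
   functions on U. *)
Definition rigid_holomorphic (U : set C) (f : C -> C) : Prop :=
  forall eps : R, 0 < eps ->
    exists P Q : {poly C},
      (forall z, U z -> Q.[z] != 0) /\
      (forall z, U z -> abs (f z - P.[z] / Q.[z]) < eps).

(* Meromorphic functions take values in the projective line option C, with
   None as the point at infinity.  The ring of analytic functions on a
   connected affinoid subset of the projective line is a principal ideal
   domain, so each element of its fraction field is g / h with g and h without
   common zero.  The last clause but one excludes the constant infinity. *)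
Definition rigid_meromorphic (U : set C) (f : C -> option C) : Prop :=
  exists g h : C -> C,
    [/\ rigid_holomorphic U g, rigid_holomorphic U h,
        forall z, U z -> g z != 0 \/ h z != 0,
        exists2 z, U z & h z != 0
      & forall z, U z -> f z = if h z == 0 then None else Some (g z / h z)].

End ValuedField.

Section Infinity.
Variables (R : realType) (F : finFieldType) (C : fieldType) (abs : C -> R).
Variable iota : {rmorphism {poly F} -> C}.

(* The image of F((1/T)) in C: sums of series
   a_0 T^N + a_1 T^(N-1) + a_2 T^(N-2) + ... *)
Definition K_infty : set C :=
  [set x | exists (N : nat) (a : nat -> F),
     vcvg abs
       (fun n => \sum_(i < n) iota (a i)%:P * (iota 'X ^+ N / iota 'X ^+ i)) x].

Definition over_K_infty (p : {poly C}) : Prop := forall i, K_infty p`_i.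

Definition algebraic_over_K_infty (x : C) : Prop :=
  exists p : {poly C}, [/\ over_K_infty p, p != 0 & root p x].

(* C is a completion of an algebraic closure of F((1/T)), the latter being
   realized as the set of elements of C which are algebraic over K_infty. *)
Definition is_C_infty : Prop :=
  [/\ is_ultrametric_abs abs,
      abs (iota 'X) = #|F|%:R,
      forall p : {poly C}, over_K_infty p -> (1 < size p)%N ->
        exists x, root p x,
      forall x (eps : R), 0 < eps ->
        exists2 y, algebraic_over_K_infty y & abs (x - y) < eps
    & forall u, vcauchy abs u -> exists l, vcvg abs u l].

End Infinity.

Record C_infty (R : realType) (F : finFieldType) := MkCInfty {
  C_field :> fieldType;
  C_abs : C_field -> R;
  C_emb : {rmorphism {poly F} -> C_field};
  C_inftyP : is_C_infty C_abs C_emb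
}.

Section DrinfeldModular.
Variables (R : realType) (F : finFieldType) (C : C_infty R F).

Local Notation q := #|F|.
Local Notation A := {poly F}.
Local Notation abs := (@C_abs R F C).
Local Notation iota := (C_emb C).
Local Notation Kinf := (K_infty abs iota).

Definition Omega : set C := ~` Kinf.

(* imag_ge c z says that the "imaginary part" inf { |z - x| : x in K_infty }
   of z is at least c. *)
Definition imag_ge (c : R) (z : C) : Prop := forall x, Kinf x -> c <= abs (z - x).

(* The standard admissible covering of Omega by connected affinoids. *)
Definition Omega_ (n : nat) : set C :=
  [set z | abs z <= q%:R ^+ n /\ imag_ge (q%:R ^- n) z].

Definition meromorphic_on_Omega (f : C -> option C) : Prop :=
  forall n, rigid_meromorphic abs (Omega_ n) f.

Definition polys_lt (n : nat) : seq A := [seq rVpoly u | u : 'rV[F]_n].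

(* The lattices A and A z + A, exhausted by coefficients of degree < n. *)
Definition lattice_A (n : nat) : seq C := [seq iota a | a <- polys_lt n].
Definition lattice_Az (z : C) (n : nat) : seq C :=
  [seq iota a * z + iota b | a <- polys_lt n, b <- polys_lt n].

(* The exponential function of the lattice L:
   e_L(w) = w * prod_(0 <> l in L) (1 - w / l). *)
Definition lattice_exp (L : nat -> seq C) (w : C) : C :=
  vlim abs (fun n => w * \prod_(l <- L n | l != 0) (1 - w / l)).

(* phi_T(X) = T X + g(z) X^q + Delta(z) X^(q^2) for the rank 2 Drinfeld module
   phi attached to A z + A, i.e. the unique polynomial such that
   e(T w) = phi_T(e(w)) for all w. *)
Definition drinfeld_phiT (z : C) : {poly C} :=
  xget 0 [set P : {poly C} | forall w,
    lattice_exp (lattice_Az z) (iota 'X * w)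
    = P.[lattice_exp (lattice_Az z) w]].

Definition Delta (z : C) : C := (drinfeld_phiT z)`_(q ^ 2).

Definition GL2A (g : 'M[A]_2) : Prop := g \in unitmx.

Definition Gamma0 (n : A) (g : 'M[A]_2) : Prop :=
  GL2A g /\ n %| g (inord 1) (inord 0).

Definition moebius (g : 'M[A]_2) (z : C) : C :=
  (iota (g (inord 0) (inord 0)) * z + iota (g (inord 0) (inord 1))) /
  (iota (g (inord 1) (inord 0)) * z + iota (g (inord 1) (inord 1))).

(* A parameter at infinity for the translations by elements of n A; up to a
   constant it is the reciprocal of the exponential function of n A. *)
Definition cusp_param (n : A) (z : C) : C :=
  (lattice_exp lattice_A (z / iota n))^-1.

(* GL2(A) permutes the cusps transitively.  For each g in GL2(A) the function
   z |-> f(g z) is invariant under translations by n A, and it must be of the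
   form sum_(i >= 0) a_i t^(i - N) in a neighbourhood of infinity, where t is
   the above parameter. *)
Definition meromorphic_at_cusps (n : A) (f : C -> option C) : Prop :=
  forall g, GL2A g ->
    exists (c : R) (N : nat) (a : nat -> C), 0 < c /\
      forall z, imag_ge c z ->
        exists2 w, f (moebius g z) = Some w &
          vcvg abs (fun m => \sum_(i < m) a i * cusp_param n z ^+ i)
                   (cusp_param n z ^+ N * w).

(* Only the values of f on Omega matter. *)
Definition modular_function (n : A) (f : C -> option C) : Prop :=
  [/\ meromorphic_on_Omega f,
      meromorphic_at_cusps n f
    & forall g, Gamma0 n g -> forall z, Omega z -> f (moebius g z) = f z].

Definition has_modular_root (n : A) (k : nat) (g : C -> C) : Prop :=
  exists2 f : C -> option C, modular_function n f &
    forall z, Omega z -> omap (fun w => w ^+ k) (f z) = Some (g z).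

Definition monic_divisors (n : A) : seq A :=
  [seq a <- polys_lt (size n) | (a \is monic) && (a %| n)].

Definition Delta_quotient (n : A) (r : A -> int) (z : C) : C :=
  \prod_(a <- monic_divisors n) Delta (iota a * z) ^ r a.

End DrinfeldModular.

Definition prime_poly (F : finFieldType) (p : {poly F}) : Prop :=
  p \is monic /\ irreducible_poly p.

(* Main.v *)
Require Import Defs.
From HB Require Import structures.
From mathcomp Require Import all_boot all_order all_algebra all_field.
From mathcomp Require Import boolp classical_sets reals.
From mathcomp Require Import ring lra zify.

(** If [g] has a [k]-th root on Omega, the growth exponent of [|g|] on every
    annulus around a point of [F(T)] is divisible by [k].

    Fix [X] in [A] and [s], and consider the annulus of those [z] with
    [q^-(s+1) < |z - X/T^s| < q^-s].  No absolute value of [F(T)] lies between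
    the two radii, so [|D z + b|] has exponent 1 or 0 there according to whether
    [- b/D] lies in the inner disc.  The polynomials [e_n] attached to the pairs
    of polynomials of degree [< n] satisfy
    [e_(n+1)(T w) = T e_n(w) prod (1 + e_n(w) / e_n((u z + v)/T))], the product
    being over the pairs [(u, v) <> 0] in [F^2].  In the limit this computes
    [phi_T], and it shows that the exponent of [|Delta(a z)|] is
    [q^2 N_n - N_(n+1)], where [N_n] counts the pairs [(c, b)] such that
    [- b/(c a)] lies in the inner disc.  Only the [c] with [deg (c a) < s]
    contribute to its dependence on [X]: the exponents for the centers [0] and
    [X/T^s] differ by [(q-1)(q^2-1)] times the number of monic [c] such that
    [deg (c a) < s] and [c a X] mod [T^s] has degree at least [deg (c a)].

    For [s = 1 + deg m] this number vanishes if [deg a > deg m], and if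
    [deg a = deg m] it is 1 or 0 according to whether the coefficient of
    [T^(deg m)] in [a X] is nonzero.  For [n = p^e] or [n = p p'] one can choose
    [X] so that this happens for [a = m] only, and induction on [deg m] gives
    [k | (q-1)(q^2-1) r_m].

    The divisibility of the exponents requires that [C] is algebraically closed,
    as the root is only known to be a quotient of uniform limits of rational
    functions without poles at the points of [C].  To see this, one shows that
    every polynomial over [F(T)] splits in [C], and concludes by density and
    continuity of roots. *)

Set Implicit Arguments.
Unset Strict Implicit.
Unset Printing Implicit Defensive.

Import Order.TTheory GRing.Theory Num.Theory.
Local Open Scope ring_scope.

(** * Splitting of polynomials *)

Section Splitting.

Lemma irreducible_factor (K : fieldType) (p : {poly K}) :
  (1 < size p)%N -> exists2 r, irreducible_poly r & r %| p.
Proof.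
have [n] := ubnP (size p); elim: n p => // n IHn p /ltnSE le_p_n p_gt1.
have [irr_p|] := pselect (irreducible_poly p); first by exists p.
move=> /not_andP[]// /existsNP[r] /not_implyP[r1] /not_implyP[rp] /negP nrp.
have p0 : p != 0 by rewrite -size_poly_gt0 ltnW.
have r0 : r != 0 by apply: contraNneq p0 => r0; rewrite -dvd0p -r0.
have ltrp : (size r < size p)%N.
  by rewrite ltn_neqAle dvdp_leq // andbT dvdp_size_eqp.
have [| |s irr_s sr] := IHn r; first exact: leq_trans le_p_n.
  by rewrite ltn_neqAle eq_sym r1 size_poly_gt0.
by exists s => //; apply: dvdp_trans rp.
Qed.

(** Induction on the degree: adjoin a root of an irreducible factor to obtain E, split the cofactor
    over E, and view the resulting extension of E as one of K. *)
Lemma splitting_extension (K : fieldType) (p : {poly K}) : p != 0 ->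
  exists (L : fieldExtType K) (rs : seq L),
    map_poly (in_alg L) p = (in_alg L (lead_coef p)) *: \prod_(z <- rs) ('X -
      z%:P).
Proof.
have [n] := ubnP (size p); elim: n K p => // n IHn K p /ltnSE le_p_n p0.
have [p1|p_gt1] := leqP (size p) 1.
  exists K^o, [::]; rewrite big_nil [p]size1_polyC // lead_coefC map_polyC /=.
  by rewrite -mul_polyC mulr1.
have [r irr_r rp] := irreducible_factor p_gt1.
have [E _ [x rx0 _]] := irredp_FAdjoin irr_r.
have /factor_theorem[q Dp] : root (map_poly (in_alg E) p) x.
  by rewrite -(divpK rp) rmorphM rootM rx0 orbT.
have q0 : q != 0.
  apply: contraNneq p0 => q0; move: Dp; rewrite q0 mul0r => /eqP.
  by rewrite map_poly_eq0.
have [|//|L [rs Dq]] := IHn E q.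
  have /(congr1 (size \o polyseq)) /= := Dp.
  by rewrite size_map_poly size_Mmonic ?monicXsubC // size_XsubC addn2 /= => <-.
exists (baseFieldType L), (in_alg L x :: rs).
have lcq : lead_coef q = in_alg E (lead_coef p).
  by rewrite -lead_coef_map Dp lead_coef_Mmonic ?monicXsubC.
have -> : map_poly (in_alg (baseFieldType L)) p =
          map_poly (in_alg L) (map_poly (in_alg E) p).
  rewrite -map_poly_comp; apply: eq_map_poly => a /=.
  by rewrite [LHS]baseField_scaleE.
rewrite Dp rmorphM /= Dq rmorphB /= map_polyX map_polyC /= big_cons.
by rewrite mulrC -scalerAr lcq; congr (_ *: _).
Qed.

(* An extension in which every polynomial over K has one root contains all the
   roots.  A splitting field of p is purely inseparable over some simple
   extension K(x), so for a suitable power N of the characteristic the N-th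
   powers of the roots of p are h_i(x) with h_i over K.  A root t of m(X^N), m
   being the minimal polynomial of x, and the N-th roots of the coefficients of
   the h_i yield N-th roots of the h_i(t^N), and these are the roots of p. *)
Lemma splits_of_has_roots (K C : fieldType) (j : {rmorphism K -> C}) (l : nat) :
    l \in [pchar K] ->
    (forall p : {poly K}, (1 < size p)%N -> exists x, root (map_poly j p) x) ->
  forall p : {poly K}, p != 0 -> exists rs : seq C,
    map_poly j p = j (lead_coef p) *: \prod_(c <- rs) ('X - c%:P).
Proof.
move=> lK hasroot p p0.
have [L [bs Dp]] := splitting_extension p0.
have [x _ /purely_inseparableP insep] :=
  separable_inseparable_decomposition {:L} 1.
have lprime := pcharf_prime lK.
have lL : l \in [pchar L] by rewrite pchar_lalg.
have lC : l \in [pchar C] by apply: rmorph_pchar lK.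
have lCX : l \in [pchar {poly C}] by rewrite pchar_poly.
have lLX : l \in [pchar {poly L}] by rewrite pchar_poly.
(* One exponent serves all roots, since further powers stay in K(x). *)
have [e he] : exists e, forall b, b \in bs -> b ^+ (l ^ e) \in <<1; x>>%VS.
  elim: bs {Dp} => [|b bs [e he]]; first by exists 0%N.
  have /purely_inseparable_elementP_pchar[n] := insep b (memvf b).
  rewrite (eq_pnat _ (pcharf_eq lL)) => /p_natP[e' ->] hb.
  exists (e + e')%N => c; rewrite inE => /predU1P[->|/he hc].
    by rewrite addnC expnD exprM rpredX.
  by rewrite expnD exprM rpredX.
set N := (l ^ e)%N in he.
have N0 : (0 < N)%N by rewrite expn_gt0 prime_gt0.
have natN (R : nzRingType) (lR : l \in [pchar R]) : [pchar R].-nat N.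
  by rewrite (eq_pnat _ (pcharf_eq lR)) pnatX pnat_id.
have /polyOver1P[m Dm] := minPolyOver 1 x.
have m_gt1 : (1 < size m)%N.
  by rewrite -(size_map_poly (in_alg L)) -Dm size_minPoly ltnS.
have [t mt] : exists t, root (map_poly j (m \Po 'X^N)) t.
  apply: hasroot; rewrite -subn_gt0 subn1 size_comp_poly size_polyXn /=.
  by rewrite muln_gt0 N0 -subn1 subn_gt0 m_gt1.
have mtN : root (map_poly j m) (t ^+ N).
  by move: mt; rewrite map_comp_poly rootE horner_comp map_polyXn hornerXn.
(* As t^N is a root of m, a relation h(x) = 0 over K specialises to h(t^N) = 0. *)
have transfer (h : {poly K}) :
    (map_poly (in_alg L) h).[x] = 0 -> (map_poly j h).[t ^+ N] = 0.
  move=> hx; have : minPoly 1 x %| map_poly (in_alg L) h.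
    by apply: minPoly_dvdp; [exact: alg_polyOver|exact/rootP].
  rewrite Dm dvdp_map => /dvdpP[h' ->].
  by rewrite rmorphM hornerM (rootP mtN) mulr0.
have rootN (a : K) : exists c : C, c ^+ N = j a.
  have [|c] := hasroot ('X^N - a%:P); first by rewrite size_XnsubC.
  rewrite rootE rmorphB /= map_polyXn map_polyC hornerD hornerN hornerXn.
  by rewrite hornerC subr_eq0 => /eqP <-; exists c.
have rootNh (h : {poly K}) : exists c : C, c ^+ N = (map_poly j h).[t ^+ N].
  elim/poly_ind: h => [|h a [c Dc]].
    by exists 0; rewrite rmorph0 horner0 expr0n eqn0Ngt N0.
  have [d Dd] := rootN a; exists (c * t + d).
  rewrite exprDn_pchar ?natN // exprMn Dc Dd rmorphD rmorphM /= map_polyX.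
  by rewrite map_polyC hornerMXaddC.
have [hs Dhs] : exists hs : seq {poly K},
    [seq (map_poly (in_alg L) h).[x] | h <- hs] = [seq b ^+ N | b <- bs].
  elim: bs he {Dp} => [|b bs IH] he; first by exists [::].
  have [|hs Dhs] := IH; first by move=> c cbs; rewrite he ?inE ?cbs ?orbT.
  have /Fadjoin1_polyP[h Dh] := he b (mem_head _ _).
  by exists (h :: hs); rewrite /= Dhs -Dh.
have [cs Dcs] : exists cs : seq C,
    [seq c ^+ N | c <- cs] = [seq (map_poly j h).[t ^+ N] | h <- hs].
  elim: hs {Dhs} => [|h hs [cs Dcs]]; first by exists [::].
  by have [c Dc] := rootNh h; exists (c :: cs); rewrite /= Dcs Dc.
(* By Frobenius, p^N = pN(X^N), so the N-th powers of the roots of p are the roots of pN. *)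
pose pN : {poly K} := \poly_(i < size p) p`_i ^+ N.
have pNE (E : fieldType) (f : {rmorphism K -> E}) (lE : l \in [pchar E]) :
    map_poly f p ^+ N = map_poly f pN \Po 'X^N.
  have sumN (I : Type) (r : seq I) (G : I -> {poly E}) :
      (\sum_(i <- r) G i) ^+ N = \sum_(i <- r) G i ^+ N.
    have lEX : l \in [pchar {poly E}] by rewrite pchar_poly.
    elim: r => [|i r IH]; first by rewrite !big_nil expr0n eqn0Ngt N0.
    by rewrite !big_cons exprDn_pchar ?natN // IH.
  rewrite -{1}[p]coefK !poly_def !rmorph_sum /= sumN.
  rewrite /pN poly_def !rmorph_sum; apply: eq_bigr => i _ /=;
    rewrite !map_polyZ /= !map_polyXn. apply: etrans (esym (comp_polyZ _ _ _)).
  by rewrite exprZn rmorphXn comp_Xn_poly -!exprM mulnC.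
(* With Y in place of x, B is the difference of lc^N prod (X - h_i(Y)) and pN. It vanishes at Y = x,
   hence by [transfer], coefficient by coefficient, at Y = t^N. *)
pose B : {poly {poly K}} :=
  (lead_coef p ^+ N)%:P *: \prod_(h <- hs) ('X - h%:P) - map_poly polyC pN.
have evB (E : fieldType) (f : {rmorphism K -> E}) (y : E) :
    map_poly (fun h => (map_poly f h).[y]) B =
    (f (lead_coef p) ^+ N) *: \prod_(h <- hs) ('X - ((map_poly f h).[y])%:P)
    - map_poly f pN.
  pose ev : {rmorphism {poly K} -> E} := horner_eval y \o map_poly f.
  have evC a : ev a%:P = f a by rewrite /ev /= /horner_eval map_polyC hornerC.
  rewrite (@eq_map_poly _ _ _ ev) // /B rmorphB /=; congr (_ - _).
    rewrite map_polyZ evC rmorphXn; congr (_ *: _).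
    rewrite rmorph_prod /=; apply: eq_bigr => h _.
    by rewrite rmorphB /= map_polyX map_polyC.
  by rewrite -map_poly_comp; apply: eq_map_poly => a; exact: evC.
have compX (E : fieldType) (g h : {poly E}) : g \Po 'X^N = h \Po 'X^N -> g = h.
  move=> gh; apply/polyP => i.
  have := congr1 (fun u : {poly E} => u`_(i * N)) gh.
  by rewrite !coef_comp_poly_Xn // dvdn_mull // mulnK.
have prodN (E : fieldType) (lE : l \in [pchar E]) (a : E) (rs : seq E) :
    (a *: \prod_(c <- rs) ('X - c%:P)) ^+ N =
    (a ^+ N *: \prod_(c <- [seq c ^+ N | c <- rs]) ('X - c%:P)) \Po 'X^N.
  have lEX : l \in [pchar {poly E}] by rewrite pchar_poly.
  rewrite comp_polyZ exprZn -prodrXl big_map rmorph_prod /=; congr (_ *: _).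
  apply: eq_bigr => c _; rewrite comp_polyB comp_polyX comp_polyC.
  by rewrite exprDn_pchar ?natN // exprNn_pchar ?natN // polyC_exp.
have BL : map_poly (fun h => (map_poly (in_alg L) h).[x]) B = 0.
  rewrite evB; apply/eqP; rewrite subr_eq0; apply/eqP/compX.
  rewrite -pNE // Dp; apply: etrans (esym (prodN L lL _ _)).
  by rewrite -Dhs big_map.
have BC : map_poly (fun h => (map_poly j h).[t ^+ N]) B = 0.
  apply/polyP => i; rewrite coef0 coef_map_id0 ?rmorph0 ?horner0 //.
  apply: transfer; have := congr1 (fun u : {poly L} => u`_i) BL.
  by rewrite coef0 coef_map_id0 ?rmorph0 ?horner0.
(* It suffices that the N-th power of the difference vanishes, and Frobenius turns this into the
   identity [BC]. *)
exists cs; apply/eqP; rewrite -subr_eq0; set d := _ - _.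
suff : d ^+ N == 0 by rewrite expf_eq0 N0.
rewrite /d exprDn_pchar ?natN // exprNn_pchar ?natN // subr_eq0 pNE //;
  apply/eqP.
apply: etrans (esym (prodN C lC _ _)); rewrite Dcs big_map.
by move: BC; rewrite evB => /eqP; rewrite subr_eq0 => /eqP <-.
Qed.

(** A root of p in a splitting field over C is integral over the coefficients, hence algebraic over
    K. A polynomial over K that kills it already splits in C, so the root lies in C. *)
Lemma splits_of_algebraic_coefs (K C : fieldType) (j : {rmorphism K -> C}) :
    (forall p : {poly K}, p != 0 -> exists rs : seq C,
       map_poly j p = j (lead_coef p) *: \prod_(c <- rs) ('X - c%:P)) ->
  forall p : {poly C}, p != 0 -> (forall i, algebraicOver j p`_i) ->
  exists rs : seq C, p = lead_coef p *: \prod_(c <- rs) ('X - c%:P).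
Proof.
move=> jsplit p p0 alg_p.
have [L [us Dp]] := splitting_extension p0.
have lpL : in_alg L (lead_coef p) != 0 by rewrite fmorph_eq0 lead_coef_eq0.
have pL0 : map_poly (in_alg L) p != 0 by rewrite map_poly_eq0.
have [cs Dcs] : exists cs : seq C, map (in_alg L) cs = us.
  have: forall u, u \in us -> root (map_poly (in_alg L) p) u.
    by move=> u uus; rewrite Dp rootZ // root_prod_XsubC.
  elim: us {Dp} => [|u us IH] hus; first by exists [::].
  have [|cs Dcs] := IH; first by move=> v vus; rewrite hus ?inE ?vus ?orbT.
  have: algebraicOver (in_alg L \o j) u.
    apply/integral_algebraic/(integral_root pL0); first exact/hus/mem_head.
    apply/integral_poly => i; rewrite coef_map.
    exact/integral_rmorph/integral_algebraic.
  case=> g g0; rewrite map_poly_comp; have [rs ->] := jsplit g g0.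
  rewrite map_polyZ rootZ ?fmorph_eq0 ?lead_coef_eq0 //.
  rewrite rmorph_prod /=.
  under eq_bigr do rewrite rmorphB /= map_polyX map_polyC.
  rewrite -(big_map (in_alg L) xpredT (fun c => 'X - c%:P)) root_prod_XsubC.
  by case/mapP => c _ ->; exists (c :: cs); rewrite /= Dcs.
exists cs; apply: (map_inj_poly (fmorph_inj (in_alg L))); first exact: rmorph0.
rewrite [LHS]Dp map_polyZ rmorph_prod /= -Dcs big_map; congr (_ *: _).
by apply: eq_bigr => c _; rewrite rmorphB /= map_polyX map_polyC.
Qed.

End Splitting.

(** * Ultrametric absolute values *)

Section UltrametricAbs.
Variables (R : realType) (C : fieldType) (abs : C -> R).
Hypothesis habs : is_ultrametric_abs abs.

Lemma vabs_ge0 x : 0 <= abs x. Proof. by case: habs. Qed.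

Lemma vabs_eq0 x : (abs x == 0) = (x == 0).
Proof. by case: habs => _ h _ _; apply/eqP/eqP => /h. Qed.

Lemma vabs_gt0 x : (0 < abs x) = (x != 0).
Proof. by rewrite lt0r vabs_ge0 andbT vabs_eq0. Qed.

Lemma vabsM x y : abs (x * y) = abs x * abs y. Proof. by case: habs. Qed.

Lemma vabs0 : abs 0 = 0. Proof. by apply/eqP; rewrite vabs_eq0. Qed.

Lemma vabs1 : abs 1 = 1.
Proof.
have a0 : abs 1 != 0 by rewrite vabs_eq0 oner_eq0.
by apply: (mulfI a0); rewrite -vabsM !mulr1.
Qed.

Lemma vabsX x n : abs (x ^+ n) = abs x ^+ n.
Proof. by elim: n => [|n IH]; rewrite ?expr0 ?vabs1 // !exprS vabsM IH. Qed.

Lemma vabs_root1 x n : (0 < n)%N -> x ^+ n = 1 -> abs x = 1.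
Proof.
move=> n0 xn; have : abs x ^+ n = 1 by rewrite -vabsX xn vabs1.
by move/eqP; rewrite pexprn_eq1 ?vabs_ge0 // eqn0Ngt n0 => /eqP.
Qed.

Lemma vabsN x : abs (- x) = abs x.
Proof.
by rewrite -mulN1r vabsM (@vabs_root1 (-1) 2) ?mul1r // sqrrN expr1n.
Qed.

Lemma vabs_dist x y : abs (x - y) = abs (y - x).
Proof. by rewrite -vabsN opprB. Qed.

Lemma vabsV x : abs x^-1 = (abs x)^-1.
Proof.
have [->|x0] := eqVneq x 0; first by rewrite invr0 vabs0 invr0.
have a0 : abs x != 0 by rewrite vabs_eq0.
by apply: (mulfI a0); rewrite -vabsM !mulfV // vabs1.
Qed.

Lemma vabs_prod (I : Type) (r : seq I) (P : pred I) (f : I -> C) :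
  abs (\prod_(i <- r | P i) f i) = \prod_(i <- r | P i) abs (f i).
Proof. exact: (big_morph _ vabsM vabs1). Qed.

Lemma vabsD x y : abs (x + y) <= Num.max (abs x) (abs y).
Proof. by case: habs. Qed.

Lemma vabsD_le x y e : abs x <= e -> abs y <= e -> abs (x + y) <= e.
Proof. by move=> xe ye; apply: le_trans (vabsD x y) _; rewrite ge_max xe ye.
Qed.

Lemma vabsD_lt x y e : abs x < e -> abs y < e -> abs (x + y) < e.
Proof.
by move=> xe ye; apply: le_lt_trans (vabsD x y) _; rewrite gt_max xe ye.
Qed.

Lemma vabsB_le x y e : abs x <= e -> abs y <= e -> abs (x - y) <= e.
Proof. by move=> xe ye; apply: vabsD_le; rewrite ?vabsN. Qed.

Lemma vabsB_lt x y e : abs x < e -> abs y < e -> abs (x - y) < e.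
Proof. by move=> xe ye; apply: vabsD_lt; rewrite ?vabsN. Qed.

Lemma vabsDl x y : abs y < abs x -> abs (x + y) = abs x.
Proof.
move=> yx; apply/le_anti/andP; split; first by apply: vabsD_le => //;
  exact: ltW.
have := vabsD (x + y) (- y); rewrite addrK vabsN le_max => /orP[//|].
by rewrite leNgt yx.
Qed.

Lemma vabsDr x y : abs x < abs y -> abs (x + y) = abs y.
Proof. by move=> xy; rewrite addrC vabsDl. Qed.

Lemma vabs_near x y : abs (x - y) < abs x -> abs y = abs x.
Proof.
by move=> xy; rewrite -[y](subKr x) vabsDl ?vabsN.
Qed.

Lemma vabsD_neq x y : abs x != abs y -> abs (x + y) = Num.max (abs x) (abs y).
Proof.
by case: ltgtP => // h _; [rewrite vabsDr|rewrite vabsDl] => //; exact: ltW.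
Qed.

Lemma vabs_sum_le (I : eqType) (r : seq I) (f : I -> C) (e : R) : 0 <= e ->
  (forall i, i \in r -> abs (f i) <= e) -> abs (\sum_(i <- r) f i) <= e.
Proof.
move=> e0; elim: r => [|i r IH] h; first by rewrite big_nil vabs0.
rewrite big_cons vabsD_le ?h ?mem_head // IH // => k kr.
by rewrite h // inE kr orbT.
Qed.

Lemma vcvg_unique u l l' : vcvg abs u l -> vcvg abs u l' -> l = l'.
Proof.
move=> ul ul'; apply/eqP; rewrite -subr_eq0; apply/negPn/negP.
rewrite -vabs_gt0 => e0; have [N hN] := ul _ e0; have [N' hN'] := ul' _ e0.
have := hN _ (leq_maxl N N'); have := hN' _ (leq_maxr N N').
set x := u _ => h1 h2; have := vabsB_lt h1 h2.
by rewrite opprB addrC addrA subrK ltxx.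
Qed.

Lemma vlimE u l : vcvg abs u l -> vlim abs u = l.
Proof.
move=> ul; rewrite /vlim; case: xgetP => [x _ ux|]; first exact: vcvg_unique ul.
by move=> /(_ l).
Qed.

Lemma vcvg_cst c : vcvg abs (fun=> c) c.
Proof. by move=> e e0; exists 0%N => n _; rewrite subrr vabs0. Qed.

Lemma vcvg_eventually (u v : nat -> C) l N : (forall n, (N <= n)%N -> u n = v
  n) ->
  vcvg abs u l -> vcvg abs v l.
Proof.
move=> uv ul e /ul[M hM]; exists (maxn N M) => n.
by rewrite geq_max => /andP[Nn Mn]; rewrite -uv ?hM.
Qed.

Lemma vcvg_shift (u : nat -> C) l : vcvg abs u l -> vcvg abs (fun n => u n.+1)
  l.
Proof. by move=> ul e /ul[N hN]; exists N => n Nn; rewrite hN // leqW. Qed.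

Lemma vcvgB u v l m : vcvg abs u l -> vcvg abs v m ->
  vcvg abs (fun n => u n - v n) (l - m).
Proof.
move=> ul vm e e0; have [N hN] := ul _ e0; have [M hM] := vm _ e0.
exists (maxn N M) => n; rewrite geq_max => /andP[Nn Mn].
by rewrite opprD opprK addrACA [- v n + m]addrC vabsD_lt ?hN // vabs_dist hM.
Qed.

Lemma vcvgD u v l m : vcvg abs u l -> vcvg abs v m ->
  vcvg abs (fun n => u n + v n) (l + m).
Proof.
move=> ul vm e e0; have [N hN] := ul _ e0; have [M hM] := vm _ e0.
exists (maxn N M) => n; rewrite geq_max => /andP[Nn Mn].
by rewrite opprD addrACA vabsD_lt ?hN ?hM.
Qed.

Lemma vcvgM u v l m : vcvg abs u l -> vcvg abs v m ->
  vcvg abs (fun n => u n * v n) (l * m).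
Proof.
move=> ul vm e e0; pose K := 1 + abs l + abs m.
have K1 : 1 <= K by rewrite /K -addrA lerDl addr_ge0 ?vabs_ge0.
have K0 : 0 < K by apply: lt_le_trans K1.
have [N hN] := ul _ (divr_gt0 e0 K0).
have [M hM] := vm _ (divr_gt0 e0 K0); have [P hP] := vm _ ltr01.
exists (maxn N (maxn M P)) => n; rewrite !geq_max => /and3P[Nn Mn Pn].
have -> : u n * v n - l * m = (u n - l) * v n + l * (v n - m) by ring.
have vK : abs (v n) <= K.
  rewrite -[v n](subrK m); apply: vabsD_le.
    by apply: le_trans K1; exact/ltW/hP.
  by rewrite /K addrC lerDl addr_ge0 ?vabs_ge0.
apply: vabsD_lt; rewrite vabsM.
  have := hN _ Nn; rewrite ltr_pdivlMr //; apply: le_lt_trans.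
  by rewrite ler_wpM2l ?vabs_ge0.
have := hM _ Mn; rewrite ltr_pdivlMr //; apply: le_lt_trans.
rewrite mulrC ler_wpM2l ?vabs_ge0 //.
by rewrite /K addrAC lerDr addr_ge0 ?vabs_ge0.
Qed.

Lemma vcvgV u l : l != 0 -> vcvg abs u l -> vcvg abs (fun n => (u n)^-1) l^-1.
Proof.
rewrite -vabs_gt0 => l0 ul e e0.
have [N hN] := ul _ l0; have [M hM] := ul _ (mulr_gt0 e0 (mulr_gt0 l0 l0)).
exists (maxn N M) => n; rewrite geq_max => /andP[Nn Mn].
have un : abs (u n) = abs l by apply: vabs_near; rewrite vabs_dist hN.
have un0 : u n != 0 by rewrite -vabs_gt0 un.
have l0' : l != 0 by rewrite -vabs_gt0.
have -> : (u n)^-1 - l^-1 = (l - u n) / (u n * l) by field; rewrite un0 l0'.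
by rewrite vabsM vabsV vabsM un ltr_pdivrMr ?mulr_gt0 // vabs_dist hM.
Qed.

Lemma vcvg_prod (I : Type) (r : seq I) (u : I -> nat -> C) (l : I -> C) :
  (forall i, vcvg abs (u i) (l i)) ->
  vcvg abs (fun n => \prod_(i <- r) u i n) (\prod_(i <- r) l i).
Proof.
move=> ul; elim: r => [|i r IH].
  by rewrite big_nil; under eq_fun do rewrite big_nil; exact: vcvg_cst.
by rewrite big_cons; under eq_fun do rewrite big_cons; exact: vcvgM.
Qed.

Lemma vcvg_abs u l : l != 0 -> vcvg abs u l ->
  exists N, forall n, (N <= n)%N -> abs (u n) = abs l.
Proof.
rewrite -vabs_gt0 => l0 /(_ _ l0)[N hN]; exists N => n Nn.
by apply: vabs_near; rewrite vabs_dist hN.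
Qed.

Lemma vcvg_horner (p : {poly C}) u l : vcvg abs u l ->
  vcvg abs (fun n => p.[u n]) p.[l].
Proof.
move=> ul; elim/poly_ind: p => [|p a IH].
  by rewrite horner0; under eq_fun do rewrite horner0; exact: vcvg_cst.
rewrite hornerMXaddC; under eq_fun do rewrite hornerMXaddC.
by apply: vcvgD; [exact: vcvgM|exact: vcvg_cst].
Qed.

(** Since e < 1, every partial product has absolute value 1, so each new factor moves the product by
    at most e. *)
Lemma vabs_prod1B (I : eqType) (r : seq I) (f : I -> C) (e : R) :
  0 <= e < 1 -> (forall i, i \in r -> abs (f i) <= e) ->
  abs (\prod_(i <- r) (1 - f i) - 1) <= e.
Proof.
move=> /andP[e0 e1]; elim: r => [|i r IH] h; first by rewrite big_nil subrr
  vabs0.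
rewrite big_cons; set P := \prod_(_ <- _) _ in IH *.
have hP : abs (P - 1) <= e by apply: IH => k kr; rewrite h // inE kr orbT.
have -> : (1 - f i) * P - 1 = (P - 1) - f i * P by ring.
have P1 : abs P = 1.
  by rewrite -vabs1; apply: vabs_near; rewrite vabs1 vabs_dist (le_lt_trans hP).
by apply: vabsB_le; rewrite // vabsM P1 mulr1 h ?mem_head.
Qed.

Lemma vabs_prod1B_eq1 (I : eqType) (r : seq I) (f : I -> C) :
  (forall i, i \in r -> abs (f i) < 1) -> abs (\prod_(i <- r) (1 - f i)) = 1.
Proof.
move=> h; rewrite vabs_prod big_seq big1 // => i ir.
by rewrite vabsDl ?vabs1 // vabsN h.
Qed.

(** * Roots of polynomials approximated by split ones *)

Section RootApproximation.

Lemma vabs_horner_le (p : {poly C}) (x : C) (B e : R) (n : nat) :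
  (size p <= n.+1)%N -> 1 <= B -> abs x <= B -> (forall i, abs p`_i <= e) ->
  abs p.[x] <= e * B ^+ n.
Proof.
move=> pn B1 xB pe; have e0 : 0 <= e by apply: le_trans (pe 0%N);
  exact: vabs_ge0.
have B0 : 0 <= B by apply: le_trans B1.
rewrite horner_coef; apply: vabs_sum_le; first by rewrite mulr_ge0 ?exprn_ge0.
move=> i _; rewrite vabsM vabsX ler_pM ?vabs_ge0 ?exprn_ge0 ?vabs_ge0 //.
apply: (@le_trans _ _ (B ^+ i)); first by rewrite lerXn2r ?nnegrE ?vabs_ge0.
by apply: ler_weXn2l => //; rewrite -ltnS (leq_trans (ltn_ord i)).
Qed.

(** If y were farther than e from every root, the product of the distances would exceed
    [e ^+ size rs]. *)
Lemma near_root_of_prod (rs : seq C) (y : C) (e : R) : 0 <= e -> (0 < size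
  rs)%N ->
  abs (\prod_(c <- rs) ('X - c%:P)).[y] <= e ^+ size rs ->
  exists2 c, c \in rs & abs (y - c) <= e.
Proof.
move=> e0 rs0; rewrite horner_prod vabs_prod => h; apply/exists2P.
apply/not_existsP => far; have {}far c : c \in rs -> e < abs (y - c).
  by move=> crs; rewrite ltNge; apply/negP => yc; apply: (far c).
suff : e ^+ size rs < \prod_(c <- rs) abs ('X - c%:P).[y] by rewrite ltNge h.
have prod_le (s : seq C) : (forall c, c \in s -> e < abs (y - c)) ->
    0 < \prod_(c <- s) abs ('X - c%:P).[y] /\
    e ^+ size s <= \prod_(c <- s) abs ('X - c%:P).[y].
  elim: s => [|c s IH] hs; first by rewrite big_nil expr0.
  have [|P0 Pe] := IH; first by move=> d ds; rewrite hs // inE ds orbT.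
  have yc : e < abs (y - c) by rewrite hs ?mem_head.
  rewrite big_cons exprS !hornerE; split; last by rewrite ler_pM ?exprn_ge0 //
    ltW.
  by rewrite mulr_gt0 // (le_lt_trans e0).
case: rs rs0 far {h} => // c rs _ far.
have yc : e < abs (y - c) by rewrite far ?mem_head.
have [|P0 Pe] := prod_le rs; first by move=> d ds; rewrite far // inE ds orbT.
rewrite big_cons exprS !hornerE; apply: le_lt_trans (ler_wpM2l e0 Pe) _.
by rewrite ltr_pM2r.
Qed.

(** By the ultrametric inequality, two terms are no farther apart than the largest step between
    them. *)
Lemma vcauchy_of_geometric (u : nat -> C) (e : nat -> R) :
    (forall n, abs (u n.+1 - u n) <= e n) ->
    (forall n, e n.+1 <= e n) -> (forall eps, 0 < eps -> exists n, e n < eps) ->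
  vcauchy abs u.
Proof.
move=> ue e_dec e_small eps /e_small[N eN]; exists N.
have dist n : abs (u (N + n)%N - u N) <= e N.
  have e_N k : e (N + k)%N <= e N.
    by elim: k => [|k IH]; rewrite ?addn0 // addnS (le_trans (e_dec _)).
  elim: n => [|n IH].
    by rewrite addn0 subrr vabs0 (le_trans (vabs_ge0 _) (ue N)).
  rewrite addnS -[u _](subrK (u (N + n)%N)) -addrA vabsD_le //.
  exact: le_trans (ue _) _.
move=> m n Nm Nn; apply: le_lt_trans eN.
rewrite -(subnKC Nm) -(subnKC Nn).
by have := vabsB_le (dist (m - N)%N) (dist (n - N)%N);
  rewrite opprB addrA subrK.
Qed.

Variables (K : fieldType) (j : {rmorphism K -> C}).
Hypothesis jsplit : forall p : {poly K}, p != 0 -> exists rs : seq C,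
  map_poly j p = j (lead_coef p) *: \prod_(c <- rs) ('X - c%:P).
Hypothesis jdense : forall x (e : R), 0 < e ->
  exists2 y, algebraicOver j y & abs (x - y) < e.
Hypothesis complete : forall u, vcauchy abs u -> exists l, vcvg abs u l.

(** By density, p is close on a disc |y| <= B to split polynomials. If |p(y)| <= h^n, a good
    approximant has a root within h of y, where p is smaller still; iterating gives a Cauchy
    sequence whose limit is a root. *)
Lemma has_root_of_dense (p : {poly C}) : p \is monic -> (1 < size p)%N ->
  exists x, root p x.
Proof.
move=> mon_p p_gt1; pose n := (size p).-1.
have Dn : size p = n.+1 by rewrite /n prednK // ltnW.
have n0 : (0 < n)%N by rewrite -ltnS -Dn.
(* B bounds the coefficients of p and of its approximants, and therefore the roots of the latter. *)
pose B := 1 + \sum_(i < size p) abs p`_i.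
have B1 : 1 <= B by rewrite lerDl sumr_ge0 // => i _; exact: vabs_ge0.
have B0 : 0 < B by apply: lt_le_trans B1.
have pB i : abs p`_i <= B.
  have [ip|pi] := ltnP i (size p); last by rewrite nth_default ?vabs0 // ltW.
  rewrite /B (bigD1 (Ordinal ip)) //= addrCA lerDl addr_ge0 // sumr_ge0 // => k
    _.
  exact: vabs_ge0.
have approx eta : 0 < eta <= 1 -> exists rs : seq C,
    [/\ size rs = n, forall c, c \in rs -> abs c <= B &
     forall y, abs y <= B ->
       abs (p - \prod_(c <- rs) ('X - c%:P)).[y] <= eta * B ^+ n].
  move=> /andP[eta0 eta1].
  have /choice[a ha] : forall i, exists y,
      algebraicOver j y /\ abs (p`_i - y) < eta.
    by move=> i; have [y ? ?] := jdense p`_i eta0; exists y.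
  pose r : {poly C} := \poly_(i < n) a i; pose p' := 'X^n + r.
  have sr : (size r < size ('X^n : {poly C}))%N.
    by rewrite size_polyXn ltnS size_poly.
  have lp' : lead_coef p' = 1 by rewrite /p' lead_coefDl // lead_coefXn.
  have sp' : size p' = n.+1 by rewrite /p' size_polyDl // size_polyXn.
  have p'0 : p' != 0 by rewrite -lead_coef_eq0 lp' oner_eq0.
  have p'E i : p'`_i = if (i < n)%N then a i else (i == n)%:R.
    rewrite /p' coefD coefXn coef_poly; case: ltnP => [lt_in|_];
      last by rewrite addr0.
    by rewrite ltn_eqF ?add0r.
  have aB i : abs (a i) <= B.
    rewrite -[a i](subKr p`_i); apply: vabsB_le => //.
    by apply: le_trans B1; apply: le_trans eta1; exact/ltW/(ha i).2.
  have [|rs] := splits_of_algebraic_coefs jsplit p'0.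
    move=> i; rewrite p'E; case: ifP => _; first exact: (ha i).1.
    by case: eqP => _; [exact: algebraic1|exact: algebraic0].
  rewrite lp' scale1r => Dp'; exists rs; rewrite -Dp'; split.
  - by apply/eqP; rewrite -eqSS -(size_prod_XsubC rs id) -Dp' sp'.
  (* A root c with |c| > B would satisfy |c|^n <= B |c|^(n-1). *)
  - move=> c crs; rewrite leNgt; apply/negP => cB.
    have c0 : 0 < abs c by apply: lt_trans cB.
    have : p'.[c] = 0 by apply/rootP; rewrite Dp' root_prod_XsubC.
    rewrite hornerD hornerXn => /eqP; rewrite addr_eq0 => /eqP Dc.
    have : abs c ^+ n <= B * abs c ^+ n.-1.
      rewrite -vabsX Dc vabsN /r horner_poly; apply: vabs_sum_le => [|i _].
        by rewrite mulr_ge0 ?exprn_ge0 // ltW.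
      rewrite vabsM vabsX ler_pM ?vabs_ge0 ?exprn_ge0 ?vabs_ge0 //.
      apply: ler_weXn2l; first by rewrite ltW // (le_lt_trans B1).
      by rewrite -ltnS prednK.
    rewrite -{1}(prednK n0) exprS ler_pM2r ?exprn_gt0 //.
    by rewrite leNgt cB.
  - move=> y yB; apply: vabs_horner_le => // [|i].
      by rewrite (leq_trans (size_polyD _ _)) // size_polyN geq_max sp' Dn
        leqnn.
    rewrite coefB p'E; case: ltngtP => [lt_in|lt_ni|->].
    + exact/ltW/(ha i).2.
    + by rewrite nth_default ?Dn // subrr vabs0 ltW.
    + have -> : p`_n = 1 by move/monicP: mon_p; rewrite /lead_coef -/n.
      by rewrite subrr vabs0 ltW.
pose h i : R := 2^-1 ^+ i.
have h0 i : 0 < h i by rewrite exprn_gt0 // invr_gt0.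
have hS i : h i.+1 <= h i.
  by rewrite /h exprS ler_piMl ?(ltW (h0 i)) // invf_le1 // ler1n.
have h1 i : h i <= 1 by elim: i => [|i IH]; rewrite ?(le_trans (hS i)) // /h
  expr0.
have step i (y : C) : abs y <= B -> abs p.[y] <= h i ^+ n ->
    exists2 y', abs (y' - y) <= h i & abs y' <= B /\ abs p.[y'] <= h i.+1 ^+ n.
  (* With this eta the approximant differs from p by at most h_(i+1)^n on the disc, so p is that
     small at each of its roots. *)
  move=> yB py; pose eta := h i.+1 ^+ n / B ^+ n.
  have etaB : eta * B ^+ n = h i.+1 ^+ n by rewrite divfK // expf_neq0 //
    gt_eqF.
  have eta01 : 0 < eta <= 1.
    apply/andP; split; first by apply: divr_gt0; apply: exprn_gt0.
    rewrite /eta ler_pdivrMr ?exprn_gt0 // mul1r.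
    apply: (@le_trans _ _ 1); last exact: exprn_ege1.
    by apply: exprn_ile1; rewrite ?h1 // ltW.
  have [rs [srs rsB near_p]] := approx _ eta01.
  have [|||c crs yc] := @near_root_of_prod rs y (h i).
  - exact: ltW.
  - by rewrite srs.
  - set q := \prod_(_ <- _) _ in near_p *; rewrite -(subKr p q) hornerD hornerN
    srs.
    apply: vabsB_le => //; apply: le_trans (near_p _ yB) _.
    by rewrite etaB lerXn2r ?nnegrE ?(ltW (h0 _)).
  exists c; first by rewrite vabs_dist.
  split; first exact: rsB.
  have := near_p c (rsB _ crs); rewrite etaB hornerD hornerN.
  have /rootP -> : root (\prod_(c <- rs) ('X - c%:P)) c by rewrite
    root_prod_XsubC.
  by rewrite subr0.
have [y0 [y0B py0]] : exists y, abs y <= B /\ abs p.[y] <= h 0 ^+ n.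
  pose eta := (B ^+ n)^-1.
  have etaB : eta * B ^+ n = h 0 ^+ n.
    by rewrite /h expr0 expr1n mulVf // expf_neq0 // gt_eqF.
  have eta01 : 0 < eta <= 1.
    by rewrite /eta invr_gt0 exprn_gt0 //= invf_le1 ?exprn_gt0 // exprn_ege1.
  have [[|c rs] [srs rsB near_p]] := approx _ eta01;
    first by rewrite -srs in n0.
  exists c; split; first exact/rsB/mem_head.
  have := near_p c (rsB _ (mem_head _ _)); rewrite etaB hornerD hornerN.
  by rewrite big_cons hornerM hornerXsubC subrr mul0r subr0.
(* Where the bounds on y fail the successor is 0, a value that is never reached. *)
have /choice[nxt hnxt] : forall iy : nat * C, exists y',
    abs iy.2 <= B -> abs p.[iy.2] <= h iy.1 ^+ n ->
    [/\ abs (y' - iy.2) <= h iy.1, abs y' <= B & abs p.[y'] <= h iy.1.+1 ^+ n].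
  move=> [i y] /=; have [[yB py]|nP] := pselect (abs y <= B /\ abs p.[y] <= h i
    ^+ n).
    by have [y' ? [? ?]] := step i y yB py; exists y'.
  by exists 0 => yB py; case: nP.
pose u := fix u i := if i is i'.+1 then nxt (i', u i') else y0.
have hu i : abs (u i) <= B /\ abs p.[u i] <= h i ^+ n.
  by elim: i => // i [uB pu]; have [] := hnxt (i, u i) uB pu.
have hsmall e : 0 < e -> exists i, h i < e.
  move=> e0; exists (Num.truncn e^-1).+1.
  rewrite /h exprVn invf_plt ?posrE ?exprn_gt0 //.
  apply: lt_le_trans (Num.Theory.truncnS_gt _) _.
  by rewrite -natrX ler_nat ltnW // ltn_expl.
have [l ul] : exists l, vcvg abs u l.
  apply/complete/(vcauchy_of_geometric (e := h)) => // i.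
  by have [uB pu] := hu i; have [] := hnxt (i, u i) uB pu.
exists l; apply/rootP; apply: (vcvg_unique (vcvg_horner p ul)).
move=> e /hsmall[N hN]; exists N => i Ni; rewrite subr0.
apply: le_lt_trans hN; apply: le_trans (hu i).2 _.
apply: (@le_trans _ _ (h i)); last first.
  rewrite -(subnKC Ni); elim: (i - N)%N => [|k IH]; rewrite ?addn0 // addnS.
  exact: le_trans (hS _) IH.
rewrite -(prednK n0) exprS ler_piMr ?(ltW (h0 _)) //.
by apply: exprn_ile1; rewrite ?h1 // ltW.
Qed.

Lemma splits_of_dense (p : {poly C}) : p != 0 ->
  exists rs : seq C, p = lead_coef p *: \prod_(c <- rs) ('X - c%:P).
Proof.
have [n] := ubnP (size p); elim: n p => // n IHn p /ltnSE le_p_n p0.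
have lp0 : lead_coef p != 0 by rewrite lead_coef_eq0.
have [p1|p_gt1] := leqP (size p) 1.
  exists [::]; rewrite big_nil [p]size1_polyC // lead_coefC.
  by rewrite -mul_polyC mulr1.
have [||x] := @has_root_of_dense ((lead_coef p)^-1 *: p).
- by rewrite monicE lead_coefZ mulVf.
- by rewrite size_scale ?invr_eq0.
rewrite rootZ ?invr_eq0 // => /factor_theorem[q Dp].
have q0 : q != 0 by apply: contraNneq p0 => q0; rewrite Dp q0 mul0r.
have [|//|rs Dq] := IHn q.
  by move: le_p_n; rewrite Dp size_Mmonic ?monicXsubC // size_XsubC addn2.
exists (x :: rs); rewrite big_cons mulrC scalerAl {1}Dp {1}Dq; congr (_ * _).
by rewrite Dp lead_coef_Mmonic ?monicXsubC.
Qed.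

End RootApproximation.
End UltrametricAbs.

(** * The field C is algebraically closed *)

Lemma fraction_repr (A : idomainType) (x : {fraction A}) :
  exists n d : A, d != 0 /\ x * tofrac d = tofrac n.
Proof.
elim/quotW: x => x; exists \n_x, \d_x; split; first exact: denom_ratioP.
rewrite !piE; apply/eqmodP; rewrite /= FracField.equivfE.
rewrite /FracField.mulf !numden_Ratio ?oner_eq0 ?mulr1 ?mul1r ?denom_ratioP //.
by rewrite mulrC.
Qed.

(** A numerator and a denominator are chosen for every fraction; [j0E] shows that the quotient of
    their images does not depend on the choice, and the morphism laws follow. *)
Lemma fraction_extend (A : idomainType) (E : fieldType) (f : {rmorphism A ->
  E}) :
  injective f ->
  exists j : {rmorphism {fraction A} -> E}, forall a, j (tofrac a) = f a.
Proof.
move=> f_inj.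
have f0 d : d != 0 -> f d != 0 by rewrite -(inj_eq f_inj) rmorph0.
have /choice[nd hnd] : forall x : {fraction A}, exists nd : A * A,
    nd.2 != 0 /\ x * tofrac nd.2 = tofrac nd.1.
  by move=> x; have [n [d ?]] := fraction_repr x; exists (n, d).
pose j0 x := f (nd x).1 / f (nd x).2.
have j0E x n d : d != 0 -> x * tofrac d = tofrac n -> j0 x = f n / f d.
  move=> d0 xd; have [d'0 xd'] := hnd x.
  apply/eqP; rewrite /j0 eqr_div ?f0 // -!rmorphM; apply/eqP; congr (f _).
  apply/eqP; rewrite -(tofrac_eq ((nd x).1 * d)) !tofracM -xd -xd'.
  by rewrite mulrAC.
have j0B : zmod_morphism j0.
  move=> x y; have [dx0 Dx] := hnd x; have [dy0 Dy] := hnd y.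
  rewrite (@j0E (x - y) ((nd x).1 * (nd y).2 - (nd y).1 * (nd x).2)
    ((nd x).2 * (nd y).2)) ?mulf_neq0 //.
    rewrite /j0 rmorphB !rmorphM; field; rewrite !f0 //.
  by rewrite tofracB !tofracM -Dx -Dy; ring.
have j0M : monoid_morphism j0.
  split; first by rewrite (@j0E 1 1 1) ?oner_eq0 ?mul1r // !rmorph1 divr1.
  move=> x y; have [dx0 Dx] := hnd x; have [dy0 Dy] := hnd y.
  rewrite (@j0E (x * y) ((nd x).1 * (nd y).1)
    ((nd x).2 * (nd y).2)) ?mulf_neq0 //.
    by rewrite /j0 !rmorphM mulf_div.
  by rewrite !tofracM -Dx -Dy mulrACA.
pose aM := GRing.isZmodMorphism.Build _ _ j0 j0B.
pose mM := GRing.isMonoidMorphism.Build _ _ j0 j0M.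
pose j : {rmorphism {fraction A} -> E} := HB.pack j0 aM mM.
exists j => a; rewrite /= (@j0E _ a 1) ?oner_eq0 ?rmorph1 ?divr1 //.
by rewrite mulr1.
Qed.

Section CInfty.
Variables (R : realType) (F : finFieldType) (C : C_infty R F).

Local Notation q := #|F|.
Local Notation A := {poly F}.
Local Notation abs := (@C_abs R F C).
Local Notation iota := (C_emb C).
Local Notation T := (iota 'X).

Lemma C_ultra : is_ultrametric_abs abs.
Proof. by case: (C_inftyP C). Qed.

Lemma vabs_T : abs T = q%:R.
Proof. by case: (C_inftyP C). Qed.

Lemma q_gt1 : (1 < q)%N. Proof. exact: finNzRing_gt1. Qed.

Lemma qR_gt1 : 1 < q%:R :> R. Proof. by rewrite ltr1n q_gt1. Qed.

Lemma qR_gt0 : 0 < q%:R :> R. Proof. by rewrite ltr0n ltnW ?q_gt1. Qed.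

(** Nonzero constants are roots of unity. *)
Lemma vabs_iotaC (c : F) : c != 0 -> abs (iota c%:P) = 1.
Proof.
move=> c0; apply: (vabs_root1 C_ultra (n := q.-1));
  first by rewrite -subn1 subn_gt0 q_gt1.
rewrite -rmorphXn -polyC_exp; suff -> : c ^+ q.-1 = 1 by rewrite rmorph1.
by apply: (mulfI c0); rewrite -exprS prednK ?expf_card ?mulr1 // ltnW // q_gt1.
Qed.

Lemma vabs_iotaC_le (c : F) : abs (iota c%:P) <= 1.
Proof.
have [->|c0] := eqVneq c 0; last by rewrite vabs_iotaC.
by rewrite rmorph0 (vabs0 C_ultra).
Qed.

(** Induction along Horner's scheme: |p X| is at least q when p is nonzero, which exceeds the
    absolute value of the constant coefficient. *)
Lemma vabs_iota (p : A) : p != 0 -> abs (iota p) = q%:R ^+ (size p).-1.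
Proof.
elim/poly_ind: p => [|p c IH]; first by rewrite eqxx.
have [-> {IH}|p0 _] := eqVneq p 0.
  rewrite mul0r add0r size_polyC => c0; rewrite vabs_iotaC;
    first by case: (c != 0).
  by apply: contraNneq c0 => ->.
have sp : (0 < size p)%N by rewrite size_poly_gt0.
have pX : abs (iota (p * 'X)) = q%:R ^+ size p.
  by rewrite rmorphM (vabsM C_ultra) vabs_T IH // -exprSr prednK.
rewrite rmorphD (vabsDl C_ultra) pX.
  by rewrite size_MXaddC (negbTE p0).
by apply: le_lt_trans (vabs_iotaC_le c) _; rewrite exprn_egt1 ?qR_gt1 // -lt0n.
Qed.

Lemma iota_eq0 (p : A) : (iota p == 0) = (p == 0).
Proof.
apply/idP/idP => [|/eqP ->]; last by rewrite rmorph0.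
apply: contraTT => p0; rewrite -(vabs_gt0 C_ultra) vabs_iota //.
by rewrite exprn_gt0 // qR_gt0.
Qed.

Lemma iota_inj : injective iota.
Proof.
by move=> x y /eqP; rewrite -subr_eq0 -rmorphB iota_eq0 subr_eq0 => /eqP.
Qed.

Lemma T_neq0 : T != 0. Proof. by rewrite iota_eq0 polyX_eq0. Qed.

Lemma K_infty_iota (p : A) : K_infty abs iota (iota p).
Proof.
(* The leading exponent is [size p] rather than the degree, so the coefficient at index 0 is 0. *)
exists (size p), (fun i => if (i <= size p)%N then p`_(size p - i) else 0).
apply: (@vcvg_eventually _ _ _ (fun=> iota p) _ _ (size p).+1); last first.
  exact: (vcvg_cst C_ultra).
move=> n pn; rewrite -(subnKC pn) big_split_ord /= [X in _ + X]big1 ?addr0;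
  last first.
  by move=> i _; rewrite leqNgt leq_addr /= polyC0 rmorph0 mul0r.
rewrite -{1}[p]coefK poly_def rmorph_sum big_ord_recl /= subn0 nth_default //.
rewrite polyC0 rmorph0 mul0r add0r [RHS](reindex_inj rev_ord_inj) /=.
apply: eq_bigr => i _; rewrite /bump /= add1n subnSK // leq_subr.
rewrite subKn; last by rewrite ltnW.
rewrite -mul_polyC rmorphM /= rmorphXn; congr (_ * _).
by rewrite -expfB_cond ?(negbTE T_neq0) ?leq_subr // subKn // ltnW.
Qed.

Local Notation K := {fraction A}.

Lemma K_infty_approx (j : {rmorphism K -> C}) : (forall a, j (tofrac a) = iota
  a) ->
  forall x e, K_infty abs iota x -> 0 < e -> exists a : K, abs (x - j a) < e.
Proof.
move=> jE x e [N [a xa]] /xa[M /(_ M (leqnn _))].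
rewrite (vabs_dist C_ultra) => hM.
exists (\sum_(i < M) tofrac (a i)%:P * (tofrac 'X ^+ N / tofrac 'X ^+ i)).
rewrite rmorph_sum /=; move: hM; congr (abs (_ - _) < _).
by apply: eq_bigr => i _; rewrite rmorphM fmorph_div !rmorphXn !jE.
Qed.

(** Clearing denominators puts the coefficients of a polynomial over F(T) into A, inside K_infty, so
    it has a root; hence all these polynomials split in C. Elements algebraic over F(T) are dense:
    one algebraic over K_infty is close to a root of a polynomial over F(T) that approximates its
    equation. *)
Theorem C_infty_splits (p : {poly C}) : p != 0 ->
  exists rs : seq C, p = lead_coef p *: \prod_(c <- rs) ('X - c%:P).
Proof.
have [j jE] := fraction_extend iota_inj.
have [_ _ hasroot dense complete] := C_inftyP C.
have [l _ lF] := finPcharP F.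
have lK : l \in [pchar K].
  by apply: (rmorph_pchar (@tofrac A)); rewrite pchar_poly.
have rootK (g : {poly K}) : (1 < size g)%N -> exists x, root (map_poly j g) x.
  move=> g_gt1.
  have [d d0 [h Dh]] : exists2 d : A, d != 0 &
      exists h : {poly A}, tofrac d *: g = map_poly (@tofrac _) h.
    elim/poly_ind: g {g_gt1} => [|g c [d d0 [h Dh]]].
      by exists 1; rewrite ?oner_eq0 //; exists 0; rewrite scaler0 rmorph0.
    have [m [d' [d'0 Dc]]] := fraction_repr c.
    exists (d * d'); rewrite ?mulf_neq0 //; exists (d' *: h * 'X + (d * m)%:P).
    rewrite [RHS]rmorphD [X in _ = X + _]rmorphM /= map_polyX map_polyC /=
      map_polyZ /= -Dh.
    rewrite !tofracM -Dc scalerDr scalerA scalerAl [tofrac d' * _]mulrC;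
      congr (_ + _).
    by rewrite -mul_polyC -polyCM; congr (_%:P); ring.
  have [||x] := hasroot (map_poly j (tofrac d *: g)).
  - move=> i; rewrite Dh -map_poly_comp coef_map_id0 /= ?jE ?rmorph0 //.
    exact: K_infty_iota.
  - by rewrite size_map_poly size_scale ?tofrac_eq0.
  rewrite map_polyZ rootZ ?fmorph_eq0 ?tofrac_eq0 // => gx.
  by exists x.
have jsplit := splits_of_has_roots lK rootK.
apply: (splits_of_dense C_ultra jsplit) => // x e e0.
have [y [p' [Kp' p'0 p'y]] xy] := dense x e e0.
suff [c algc yc] : exists2 c, algebraicOver j c & abs (y - c) < e.
  exists c => //; have := vabsD_lt C_ultra xy yc.
  by rewrite addrA subrK.
pose n := (size p').-1.
have sp' : (1 < size p')%N.
  rewrite ltnNge; apply: contra p'0 => /size1_polyC Dp'.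
  by move: p'y; rewrite Dp' rootC => /eqP ->.
have Dn : size p' = n.+1 by rewrite /n prednK // ltnW.
have n0 : (0 < n)%N by rewrite -ltnS -Dn.
pose B := Num.max 1 (abs y).
have B1 : 1 <= B by rewrite le_max lexx.
have Bn0 : 0 < B ^+ n by rewrite exprn_gt0 // (lt_le_trans ltr01).
pose lc := abs (lead_coef p').
have lc0 : 0 < lc by rewrite (vabs_gt0 C_ultra) lead_coef_eq0.
pose e' := e / 2.
have e'0 : 0 < e' by rewrite divr_gt0.
(* The first bound preserves the absolute value of the leading coefficient; the second makes |g(y)|
   at most lc e'^n, so that some root of g lies within e' < e of y. *)
pose eta := Num.min lc (e' ^+ n * lc / B ^+ n).
have eta0 : 0 < eta.
  rewrite lt_min lc0; apply: divr_gt0 Bn0; apply: mulr_gt0 lc0.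
  exact: exprn_gt0.
have /choice[a ha] : forall i, exists a : K, abs (p'`_i - j a) < eta.
  by move=> i; apply: K_infty_approx.
pose g : {poly K} := \poly_(i < n.+1) a i.
have an : abs (j (a n)) = lc.
  apply: (vabs_near C_ultra); rewrite /lead_coef -/n.
  by apply: lt_le_trans (ha n) _; rewrite ge_min lexx.
have an0 : a n != 0.
  by apply: contraTneq lc0 => an0; rewrite -an an0 rmorph0 (vabs0 C_ultra) ltxx.
have sg : size g = n.+1 by rewrite size_poly_eq.
have lg : lead_coef g = a n by rewrite lead_coef_poly.
have g0 : g != 0 by rewrite -size_poly_eq0 sg.
have [rs Dg] := jsplit g g0.
have srs : size rs = n.
  apply/eqP; rewrite -eqSS -(size_prod_XsubC rs id) -sg -(size_map_poly j) Dg.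
  by rewrite size_scale // fmorph_eq0 lg.
have [|||c crs yc] := near_root_of_prod C_ultra (rs := rs) (y := y) (e := e').
- exact: ltW.
- by rewrite srs.
- have : abs (map_poly j g).[y] <= eta * B ^+ n.
    have -> : (map_poly j g).[y] = (map_poly j g - p').[y].
      by rewrite hornerD hornerN (rootP p'y) subr0.
    apply: (vabs_horner_le C_ultra) => //.
    - by rewrite (leq_trans (size_polyD _ _)) // size_polyN geq_max
      size_map_poly sg Dn leqnn.
    - by rewrite le_max lexx orbT.
    - move=> i; rewrite coefB; case: (ltnP i n.+1) => ni.
        by rewrite coef_map coef_poly ni (vabs_dist C_ultra) ltW.
      by rewrite !nth_default ?size_map_poly ?sg ?Dn // subrr (vabs0 C_ultra)
        ltW.
  rewrite Dg hornerZ (vabsM C_ultra) lg an => h.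
  rewrite -(ler_pM2l lc0) srs (le_trans h) // mulrC -ler_pdivlMl // mulrC.
  by rewrite /eta ge_min [lc * _]mulrC lexx orbT.
exists c; last by apply: le_lt_trans yc _; rewrite ltr_pdivrMr // ltr_pMr //
  ltr1n.
exists g => //; rewrite Dg rootZ ?fmorph_eq0 ?lg //.
by rewrite root_prod_XsubC.
Qed.

End CInfty.

(** * Growth exponents on annuli *)

Section Annulus.
Variables (R : realType) (F : finFieldType) (C : C_infty R F).

Local Notation q := #|F|.
Local Notation A := {poly F}.
Local Notation abs := (@C_abs R F C).
Local Notation iota := (C_emb C).
Local Notation T := (iota 'X).
Let ultra := C_ultra C.
Let q_gt1R := qR_gt1 R F.
Let q_gt0R := qR_gt0 R F.

Variables (X : A) (s : nat).

Definition center : C := iota X / T ^+ s.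

Definition annulus : set C :=
  [set z | q%:R ^- s.+1 < abs (z - center) < q%:R ^- s].

(* The annulus is chosen so that no absolute value of F(T) falls in its range of
   radii. *)
Lemma fraction_small (P Q : A) : Q != 0 -> (size P + s < size Q)%N ->
  abs (iota P / iota Q) <= q%:R ^- s.+1.
Proof.
move=> Q0 PQ; have [->|P0] := eqVneq P 0.
  by rewrite rmorph0 mul0r (vabs0 ultra) invr_ge0 exprn_ge0 // ltW.
rewrite (vabsM ultra) (vabsV ultra) !vabs_iota // ler_pdivrMr ?exprn_gt0 //.
rewrite mulrC ler_pdivlMr ?exprn_gt0 // -exprD ler_weXn2l ?(ltW q_gt1R) //.
by move: P0 PQ; rewrite -size_poly_gt0; lia.
Qed.

Lemma fraction_big (P Q : A) : P != 0 -> Q != 0 -> (size Q <= size P + s)%N ->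
  q%:R ^- s <= abs (iota P / iota Q).
Proof.
move=> P0 Q0 PQ.
rewrite (vabsM ultra) (vabsV ultra) !vabs_iota // ler_pdivlMr ?exprn_gt0 //.
rewrite mulrC ler_pdivrMr ?exprn_gt0 // -exprD ler_weXn2l ?(ltW q_gt1R) //.
by move: P0 Q0 PQ; rewrite -!size_poly_gt0; lia.
Qed.

Lemma annulus_fraction (P Q : A) z : Q != 0 -> annulus z ->
  abs (z - center + iota P / iota Q) =
  Num.max (abs (z - center)) (abs (iota P / iota Q)).
Proof.
move=> Q0 /andP[z1 z2]; apply: (vabsD_neq ultra).
have [PQ|PQ] := ltnP (size P + s) (size Q).
  by rewrite gt_eqF // (le_lt_trans _ z1) // fraction_small.
have [->|P0] := eqVneq P 0.
  by rewrite rmorph0 mul0r (vabs0 ultra) gt_eqF // (lt_trans _ z1) // invr_gt0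
    exprn_gt0.
by rewrite lt_eqF // (lt_le_trans z2) // fraction_big.
Qed.

Lemma annulus_gt0 z : annulus z -> 0 < abs (z - center).
Proof. by case/andP => z1 _; apply: lt_trans z1; rewrite invr_gt0 exprn_gt0.
Qed.

(** Partial sums of the series for y are fractions, and by [annulus_fraction] no fraction is closer
    to z than [center]. *)
Lemma annulus_imag z : annulus z ->
  imag_ge (q%:R ^- s.+1) z.
Proof.
move=> zA y [N [a ya]].
have e0 : 0 < q%:R ^- s.+1 :> R by rewrite invr_gt0 exprn_gt0.
have [M /(_ M (leqnn M))] := ya _ e0; set yM := \sum_(_ < _) _ => yyM.
pose P : A := X * 'X^M - 'X^s * \sum_(i < M) (a i)%:P * ('X^N * 'X^(M - i)).
have T0 n : T ^+ n != 0 by rewrite expf_neq0 // T_neq0.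
have DyM : center - yM = iota P / iota ('X^s * 'X^M).
  rewrite !rmorphB !rmorphM !rmorphXn rmorph_sum /=.
  apply: (mulIf (mulf_neq0 (T0 s) (T0 M))); rewrite divfK ?mulf_neq0 //.
  rewrite mulrBl /center mulrA divfK //; congr (_ - _).
  rewrite mulrCA; congr (_ * _).
  rewrite /yM mulr_suml; apply: eq_bigr => i _.
  rewrite !rmorphM !rmorphXn /= -!mulrA; congr (_ * (_ * _)).
  have -> : T ^+ M = T ^+ i * T ^+ (M - i) by rewrite -exprD subnKC // ltnW.
  by rewrite mulKf.
have /annulus_fraction -/(_ P) h : 'X^s * 'X^M != 0 :> A.
  by rewrite mulf_neq0 // expf_neq0 ?polyX_eq0.
have zyM : q%:R ^- s.+1 <= abs (z - yM).
  rewrite -(subrK center z) -addrA DyM h // le_max.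
  by case/andP: zA => /ltW ->.
rewrite leNgt; apply/negP => zy.
have := vabsB_lt ultra zy yyM; rewrite opprB addrA subrK => zyM'.
by have := lt_le_trans zyM' zyM; rewrite ltxx.
Qed.

Lemma annulus_Omega z : annulus z -> Omega z.
Proof.
move=> /annulus_imag zi Kz; have := zi z Kz.
by rewrite subrr (vabs0 ultra) leNgt invr_gt0 exprn_gt0.
Qed.

Lemma vabs_center_le : abs center <= q%:R ^+ size X.
Proof.
have [X0|X0] := eqVneq X 0.
  by rewrite /center X0 rmorph0 mul0r (vabs0 ultra) exprn_ge0 // ltW.
rewrite /center (vabsM ultra) (vabsV ultra) (vabsX ultra) vabs_T vabs_iota //.
rewrite ler_pdivrMr ?exprn_gt0 // -exprD ler_weXn2l ?(ltW q_gt1R) //.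
by rewrite (leq_trans (leq_pred _)) // leq_addr.
Qed.

Lemma vabs_annulus_le z : annulus z -> abs z <= q%:R ^+ size X.
Proof.
case/andP => _ z2; rewrite -(subrK center z); apply: (vabsD_le ultra).
  apply: le_trans (ltW z2) _; apply: (@le_trans _ _ 1).
    by rewrite invf_le1 ?exprn_gt0 // exprn_ege1 // ltW.
  by rewrite exprn_ege1 // ltW.
exact: vabs_center_le.
Qed.

(** A single affinoid of the covering contains the annulus, so a meromorphic function is one
    quotient g / h there. *)
Lemma annulus_sub_Omega_ : exists n, forall z, annulus z -> Omega_ n z.
Proof.
exists (size X + s.+1)%N => z zA; split.
  apply: le_trans (vabs_annulus_le zA) _.
  by rewrite ler_weXn2l ?(ltW q_gt1R) // leq_addr.
move=> y /(annulus_imag zA); apply: le_trans.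
by rewrite lef_pV2 ?posrE ?exprn_gt0 // ler_weXn2l ?(ltW q_gt1R) // leq_addl.
Qed.

Definition monomial (f : C -> R) (e : int) : Prop :=
  exists2 c : R, 0 < c & forall z, annulus z -> f z = c * abs (z - center) ^ e.

Lemma eq_monomial f g e : (forall z, annulus z -> f z = g z) ->
  monomial f e -> monomial g e.
Proof. by move=> fg [c c0 fc]; exists c => // z zA; rewrite -fg ?fc. Qed.

Lemma monomial_cst c : 0 < c -> monomial (fun=> c) 0.
Proof. by move=> c0; exists c => // z _; rewrite expr0z mulr1. Qed.

Lemma monomialM f g d e : monomial f d -> monomial g e ->
  monomial (fun z => f z * g z) (d + e).
Proof.
move=> [b b0 fb] [c c0 gc]; exists (b * c); first exact: mulr_gt0.
move=> z zA; rewrite fb // gc // expfzDr ?gt_eqF ?annulus_gt0 //.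
by rewrite mulrACA.
Qed.

Lemma monomialXz f d e : monomial f d -> monomial (fun z => f z ^ e) (d * e).
Proof.
move=> [b b0 fb]; exists (b ^ e); first exact: exprz_gt0.
by move=> z zA; rewrite fb // expfzMl exprz_exp.
Qed.

Lemma monomialV f d : monomial f d -> monomial (fun z => (f z)^-1) (- d).
Proof.
move=> /monomialXz -/(_ (-1)); rewrite mulrN1; apply: eq_monomial => z _.
by rewrite exprN1.
Qed.

Lemma monomial_prod (I : eqType) (r : seq I) (P : pred I) (f : I -> C -> R)
    (e : I -> int) :
  (forall i, i \in r -> P i -> monomial (f i) (e i)) ->
  monomial (fun z => \prod_(i <- r | P i) f i z) (\sum_(i <- r | P i) e i).
Proof.
elim: r => [|i r IH] h.
  rewrite big_nil; apply: eq_monomial (monomial_cst ltr01) => z _.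
  by rewrite big_nil.
have {}IH := IH (fun k kr => h k (@mem_behead _ (i :: r) k kr)).
rewrite big_cons; case: ifP => Pi.
  apply: eq_monomial (monomialM (h i (mem_head _ _) Pi) IH) => z _.
  by rewrite big_cons Pi.
by apply: eq_monomial IH => z _; rewrite big_cons Pi.
Qed.

(* The exponent of [|D z + b|] on the annulus: 1 if the zero [- b / D] lies in
   the inner disc, and 0 otherwise. *)
Definition inner (D b : A) : bool :=
  (D != 0) && (size (D * X + b * 'X^s)%R < size D)%N.

(** Factor out D: what remains is [z - center] plus a fraction. *)
Lemma vabs_linear (D b : A) z : D != 0 -> annulus z ->
  abs (iota D * z + iota b) = abs (iota D) *
    Num.max (abs (z - center)) (abs (iota (D * X + b * 'X^s) / iota (D *
      'X^s))).
Proof.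
move=> D0 zA; rewrite -annulus_fraction //; last first.
  by rewrite mulf_neq0 // expf_neq0 // polyX_eq0.
rewrite -(vabsM ultra); congr (abs _).
rewrite /center rmorphD !rmorphM !rmorphXn /=; field.
by rewrite iota_eq0 D0 expf_neq0 ?T_neq0.
Qed.

(** The fraction in [vabs_linear] has absolute value at most q^-(s+1) or at least q^-s, so the same
    term of the maximum wins on the whole annulus. *)
Lemma monomial_linear (D b : A) : (D != 0) || (b != 0) ->
  monomial (fun z => abs (iota D * z + iota b)) (inner D b : nat).
Proof.
rewrite /inner; have [-> /= b0|D0 _ /=] := eqVneq D 0.
  apply: eq_monomial (monomial_cst (_ : 0 < abs (iota b))); last first.
    by rewrite (vabs_gt0 ultra) iota_eq0.
  by move=> z _; rewrite rmorph0 mul0r add0r.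
pose N := D * X + b * 'X^s.
have TD0 : D * 'X^s != 0 by rewrite mulf_neq0 // expf_neq0 // polyX_eq0.
have sTD : size (D * 'X^s) = (size D + s)%N by rewrite size_mulXn // addnC.
have iD0 : 0 < abs (iota D) by rewrite (vabs_gt0 ultra) iota_eq0.
have [ND|ND] := ltnP (size N) (size D).
  exists (abs (iota D)) => // z zA; rewrite vabs_linear // expr1z;
    congr (_ * _).
  apply: max_l; apply: le_trans (fraction_small TD0 _) _.
    by rewrite sTD ltn_add2r.
  by case/andP: zA => /ltW.
have N0 : N != 0 by rewrite -size_poly_gt0 (leq_trans _ ND) // size_poly_gt0.
exists (abs (iota D) * abs (iota N / iota (D * 'X^s))).
  rewrite mulr_gt0 // (vabs_gt0 ultra) mulf_neq0 ?invr_eq0 ?iota_eq0 //.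
move=> z zA; rewrite vabs_linear // expr0z mulr1; congr (_ * _); apply: max_r.
case/andP: zA => _ /ltW z2; apply: le_trans z2 _; apply: fraction_big => //.
by rewrite sTD leq_add2r.
Qed.

(** * Growth of rigid functions and of their roots *)

Lemma C_has_nth_root (c : C) n : (0 < n)%N -> exists y : C, y ^+ n = c.
Proof.
move=> n0; have p0 : 'X^n - c%:P != 0 :> {poly C} by rewrite -size_poly_gt0
  size_XnsubC.
have [[|y rs] Dp] := C_infty_splits p0.
  have := congr1 (size \o polyseq) Dp.
  rewrite /= big_nil size_XnsubC // size_scale ?lead_coef_eq0 // size_poly1.
  by case=> n00; rewrite n00 in n0.
exists y; have : root ('X^n - c%:P) y.
  by rewrite Dp rootZ ?lead_coef_eq0 // root_prod_XsubC mem_head.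
by rewrite rootE !hornerE subr_eq0 => /eqP.
Qed.

(** The radii lie strictly between consecutive powers of q, which is why a square root of T
    enters. *)
Lemma annulus_nonempty : exists z, annulus z.
Proof.
have [y y2] := C_has_nth_root T (isT : (0 < 2)%N).
have ay : abs y ^+ 2 = q%:R by rewrite -(vabsX ultra) y2 vabs_T.
have y1 : 1 < abs y.
  by rewrite -(expr_gt1 (n := 2)) ?ay ?vabs_ge0 //; exact: ultra.
have yq : abs y < q%:R.
  by rewrite -ay expr2 ltr_pMr // (lt_trans ltr01).
exists (center + y / T ^+ s.+1); rewrite /annulus /= addrC addKr.
rewrite (vabsM ultra) (vabsV ultra) (vabsX ultra) vabs_T.
rewrite -[X in X < _]mul1r ltr_pM2r ?invr_gt0 ?exprn_gt0 // y1 /=.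
rewrite ltr_pdivrMr ?exprn_gt0 // exprSr mulrA mulVf ?mul1r //.
by rewrite expf_neq0 // gt_eqF.
Qed.

(* The numerators of the approximants may vanish on the annulus, so only radii
   slightly larger than that of z0 can be controlled. *)
Lemma vabs_poly_right (p : {poly C}) z0 : p != 0 -> 0 < abs (z0 - center) ->
  exists (i : nat) (c b : R), [/\ 0 < c, abs (z0 - center) < b &
    forall z, abs (z0 - center) < abs (z - center) < b ->
      abs p.[z] = c * abs (z - center) ^+ i /\ abs p.[z0] <= abs p.[z]].
Proof.
move=> p0 r0; set r := abs (z0 - center) in r0 *.
have [rs ->] := C_infty_splits p0.
have lp0 : 0 < abs (lead_coef p) by rewrite (vabs_gt0 ultra) lead_coef_eq0.
elim: rs => [|d rs [i [c [b [c0 rb h]]]]].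
  exists 0%N, (abs (lead_coef p)), (r + 1); rewrite ltrDl; split=> // z _.
  by rewrite big_nil !hornerE ?expr0 ?mulr1.
have DE z : abs (lead_coef p *: \prod_(c <- d :: rs) ('X - c%:P)).[z] =
    abs (z - d) * abs (lead_coef p *: \prod_(c <- rs) ('X - c%:P)).[z].
  by rewrite big_cons !(hornerZ, hornerM, hornerXsubC) !(vabsM ultra) mulrCA.
have zdE z : z - d = (z - center) + (center - d) by rewrite addrA subrK.
(* A zero d in the closed disc of radius r contributes the factor |z - center| beyond r, and at most
   r at z0. A zero outside that disc contributes a constant up to its own radius. *)
have [dr|dr] := leP (abs (center - d)) r.
  exists i.+1, c, b; split=> // z zb; have [pz pz0] := h z zb.
  case/andP: zb => rz _; have dz : abs (z - d) = abs (z - center).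
    by rewrite zdE (vabsDl ultra) // (le_lt_trans dr).
  split; first by rewrite DE dz pz exprS mulrCA.
  rewrite !DE dz ler_pM ?(vabs_ge0 ultra) //.
  by rewrite zdE (vabsD_le ultra) ?(ltW rz) // (le_trans dr) ?ltW.
exists i, (abs (center - d) * c), (Num.min b (abs (center - d))).
rewrite mulr_gt0 // ?(lt_trans r0) // lt_min rb dr; split=> // z.
rewrite lt_min => /and3P[rz zb zd]; have [|pz pz0] := h z; first by rewrite rz.
have dz : abs (z - d) = abs (center - d) by rewrite zdE (vabsDr ultra zd).
have dz0 : abs (z0 - d) = abs (center - d) by rewrite zdE (vabsDr ultra dr).
split; first by rewrite DE dz pz mulrA.
by rewrite !DE dz dz0 ler_pM2l // (lt_trans r0).
Qed.

(** Each root lies in the inner closed disc, contributing exponent 1, or on or beyond the outer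
    circle, contributing 0. *)
Lemma vabs_poly_monomial (p : {poly C}) :
    p != 0 -> (forall z, annulus z -> p.[z] != 0) ->
  exists i : nat, monomial (fun z => abs p.[z]) i.
Proof.
move=> p0 nz; have [rs Dp] := C_infty_splits p0.
have lp0 : lead_coef p != 0 by rewrite lead_coef_eq0.
have {}nz d : d \in rs -> ~ annulus d.
  by move=> drs /nz; rewrite -[_ == 0]/(root p d) Dp rootZ // root_prod_XsubC
    drs.
have lin d : ~ annulus d -> exists i : nat, monomial (fun z => abs (z - d)) i.
  move=> dA; have zdE z : z - d = (z - center) - (d - center) by rewrite opprB
    addrA subrK.
  have [d1|d1] := leP (abs (d - center)) (q%:R ^- s.+1).
    exists 1%N, 1 => // z /andP[z1 _].
    rewrite mul1r expr1z zdE; apply: (vabsDl ultra); rewrite (vabsN ultra).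
    exact: le_lt_trans z1.
  have d2 : q%:R ^- s <= abs (d - center).
    by rewrite leNgt; apply/negP => d2; apply: dA; rewrite /annulus /= d1.
  exists 0%N, (abs (d - center)).
    by apply: lt_le_trans d2; rewrite invr_gt0 exprn_gt0.
  move=> z /andP[_ z2].
  rewrite expr0z mulr1 zdE -[RHS](vabsN ultra); apply: (vabsDr ultra).
  by rewrite (vabsN ultra); apply: lt_le_trans d2.
have [e he] : exists e : C -> nat, forall d, d \in rs ->
    monomial (fun z => abs (z - d)) (e d).
  have /choice[e he] : forall d, exists i : nat, d \in rs ->
      monomial (fun z => abs (z - d)) i.
    move=> d; have [drs|] := boolP (d \in rs); last by exists 0%N.
    by have [i] := lin d (nz d drs); exists i.
  by exists e.
exists (\sum_(d <- rs) e d)%N.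
have := monomialM (monomial_cst (_ : 0 < abs (lead_coef p)))
  (monomial_prod (fun i ir (_ : xpredT i) => he i ir)).
rewrite add0r => H.
have -> : (\sum_(d <- rs) e d)%N = \sum_(i <- rs) (e i : int) :> int.
  by elim: rs {Dp nz he H} => [|d rs IH]; rewrite ?big_nil // !big_cons -IH.
apply: eq_monomial (H _); last by rewrite (vabs_gt0 ultra).
move=> z _; rewrite [in RHS]Dp hornerZ (vabsM ultra) horner_prod (vabs_prod
  ultra).
by congr (_ * _); apply: eq_bigr => d _; rewrite hornerXsubC.
Qed.

Lemma nth_root_near1 (b : R) : 1 < b -> exists n0 : nat,
  forall n t, (n0 <= n)%N -> t ^+ n = q%:R -> 0 <= t -> t ^+ 2 < b.
Proof.
(* If t^2 >= b, then b^n <= t^(2n) = q^2, against Bernoulli's inequality for n >= n0. *)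
move=> b1; exists (Num.truncn (q%:R ^+ 2 / (b - 1))).+1 => n t n0 tn t0.
rewrite ltNge; apply/negP => bt.
have bn : b ^+ n <= q%:R ^+ 2.
  by rewrite -tn -exprM mulnC exprM lerXn2r ?nnegrE ?exprn_ge0 // ltW //
    (lt_trans ltr01).
have h : q%:R ^+ 2 / (b - 1) < n%:R.
  by apply: lt_le_trans (Num.Theory.truncnS_gt _) _; rewrite ler_nat.
rewrite ltr_pdivrMr ?subr_gt0 // in h.
have bern m : 1 + m%:R * (b - 1) <= b ^+ m.
  elim: m => [|m IH]; first by rewrite mul0r addr0.
  rewrite exprS; apply: le_trans (ler_wpM2l _ IH);
    last by rewrite ltW // (lt_trans ltr01).
  rewrite -natr1; have : 0 <= m%:R * (b - 1) ^+ 2 by rewrite mulr_ge0 ?sqr_ge0.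
  by nra.
by have := bern n; lra.
Qed.

(** Approximate g by P/Q with error below |g(z0)|/q. For |y| slightly above 1, |P| does not decrease
    from z0 to z1 and z2, while |Q| grows by a factor at most q; hence |P/Q| is not below the error
    bound and equals |g| at both points. The exponent is read off between z1 and z2, because P need
    not follow its monomial at z0 itself. *)
Lemma rigid_holomorphic_growth (U : set C) (g : C -> C) z0 :
    (forall z, annulus z -> U z) -> rigid_holomorphic abs U g ->
    annulus z0 -> g z0 != 0 ->
  exists (m : int) (n0 : nat), forall n y, (n0 <= n)%N -> y ^+ n = T ->
    let z1 := center + (z0 - center) * y in
    let z2 := center + (z0 - center) * y ^+ 2 in
    [/\ annulus z1, annulus z2, g z1 != 0 & abs (g z2) = abs (g z1) * abs y ^
      m].
Proof.
move=> AU hol z0A g0; have gz0 : 0 < abs (g z0) by rewrite (vabs_gt0 ultra).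
have r0 := annulus_gt0 z0A; set r := abs (z0 - center) in r0.
have [|P [Q [Q0 near]]] := hol (abs (g z0) / q%:R); first by rewrite divr_gt0.
have QA z : annulus z -> Q.[z] != 0 by move=> /AU/Q0.
have Qn0 : Q != 0 by apply: contraNneq (QA z0 z0A) => ->; rewrite horner0.
have [j [cQ cQ0 hQ]] := vabs_poly_monomial Qn0 QA.
have gz0E : abs (P.[z0] / Q.[z0]) = abs (g z0).
  apply: (vabs_near ultra); apply: lt_trans (near _ (AU _ z0A)) _.
  by rewrite ltr_pdivrMr // ltr_pMr.
have Pn0 : P != 0.
  apply: contraTneq gz0 => P0.
  by rewrite -gz0E P0 horner0 mul0r (vabs0 ultra) ltxx.
have [i [cP [b [cP0 rb hP]]]] := vabs_poly_right Pn0 r0.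
rewrite -/r in rb hP.
have b1 : 1 < Num.min b (q%:R ^- s) / r.
  by rewrite ltr_pdivlMr // mul1r lt_min rb; case/andP: z0A.
have [n1 n1P] := nth_root_near1 b1.
(* From n1 on, z1 and z2 stay within the radii controlled for P; n > 2 j gives |y|^(2j) <= q. *)
exists (i%:Z - j%:Z), (maxn n1 (2 * j).+1) => n y;
  rewrite geq_max => /andP[n1n jn] yT.
set t := abs y.
have tn : t ^+ n = q%:R by rewrite -(vabsX ultra) yT vabs_T.
have t0 : 0 <= t by exact: vabs_ge0 ultra _.
have n0 : (0 < n)%N by apply: leq_trans jn.
have t1 : 1 < t by rewrite -(expr_gt1 n0) ?tn.
have tb := n1P n t n1n tn t0; rewrite ltr_pdivlMr // lt_min in tb.
case/andP: tb => tb tq.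
have growth m : (0 < m <= 2)%N ->
    let z := center + (z0 - center) * y ^+ m in
    [/\ annulus z, abs (z - center) = r * t ^+ m &
        abs (g z) = cP * (r * t ^+ m) ^+ i / (cQ * (r * t ^+ m) ^+ j)].
  move=> /andP[m0 m2] z.
  have zE : abs (z - center) = r * t ^+ m.
    by rewrite /z addrC addKr (vabsM ultra) (vabsX ultra).
  have tm1 : 1 < t ^+ m by rewrite exprn_egt1 // -lt0n.
  have tm2 : t ^+ m <= t ^+ 2 by rewrite ler_weXn2l // ltW.
  have rm : r * t ^+ m <= t ^+ 2 * r by rewrite mulrC ler_pM2r.
  have zA : annulus z.
    rewrite /annulus /= zE (le_lt_trans rm tq) andbT.
    by case/andP: z0A => z01 _; apply: lt_trans z01 _; rewrite ltr_pMr.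
  have [|Pz Pz0] := hP z; first by rewrite zE ltr_pMr // tm1 (le_lt_trans rm).
  have Qz := hQ z zA; have Qz0 := hQ z0 z0A; rewrite zE in Pz Qz.
  split=> //; rewrite -Pz -Qz -(vabsV ultra) -(vabsM ultra).
  apply: (vabs_near ultra); rewrite (vabs_dist ultra);
    apply: lt_le_trans (near _ (AU _ zA)) _.
  have Qzq : abs Q.[z] <= abs Q.[z0] * q%:R.
    rewrite Qz Qz0 -!exprnP exprMn -!mulrA !ler_pM2l ?exprn_gt0 // -tn -exprM.
    rewrite ler_weXn2l ?(ltW t1) //; apply: leq_trans (ltnW jn).
    by rewrite leq_mul2r m2 orbT.
  have Qz_gt0 : 0 < abs Q.[z] by rewrite (vabs_gt0 ultra) QA.
  have Qz0_gt0 : 0 < abs Q.[z0] by rewrite (vabs_gt0 ultra) QA.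
  rewrite -gz0E !(vabsM ultra) !(vabsV ultra) -mulrA -invfM.
  apply: ler_pM Pz0 _; first exact: vabs_ge0 ultra _.
    by rewrite invr_ge0 mulr_ge0 // ltW.
  by rewrite lef_pV2 ?posrE ?mulr_gt0.
have [z1A z1E g1E] := growth 1%N isT; have [z2A z2E g2E] := growth 2%N isT.
rewrite expr1 in z1A z1E g1E; split=> //.
  by rewrite -(vabs_gt0 ultra) g1E expr1 divr_gt0 // mulr_gt0 // exprn_gt0 //
    mulr_gt0 // (lt_trans ltr01).
have tn0 : t != 0 by rewrite gt_eqF // (lt_trans ltr01).
rewrite g1E g2E expr1 expfzDr // -exprnN -exprnP [t ^+ 2]expr2 !exprMn.
by field; rewrite !expf_neq0 ?tn0 ?gt_eqF.
Qed.

(** Write f = u / v on an affinoid containing the annulus. From z1 to z2 the value |u/v|^k is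
    multiplied by a power of |y| with exponent divisible by k, and |g| by |y|^e; as |y| > 1, the
    exponents agree. *)
Lemma root_exponent_dvd (f : C -> option C) (g : C -> C) (k : nat) (e : int) :
    (0 < k)%N -> meromorphic_on_Omega f ->
    (forall z, Omega z -> omap (fun w => w ^+ k) (f z) = Some (g z)) ->
    monomial (fun z => abs (g z)) e ->
  (k %| e)%Z.
Proof.
move=> k0 mero fg [c c0 gc].
have [N AU] := annulus_sub_Omega_.
have [u [v [hu hv _ _ fE]]] := mero N.
have fuv z : annulus z -> [/\ u z != 0, v z != 0 & abs (g z) = (abs (u z) / abs
  (v z)) ^+ k].
  move=> zA; have := fg z (annulus_Omega zA); rewrite fE; last exact: AU.
  case: eqP => //= /eqP v0 [gE].
  have : abs (g z) != 0 by rewrite gc // gt_eqF // mulr_gt0 // exprz_gt0 //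
    annulus_gt0.
  rewrite -gE (vabsX ultra) (vabsM ultra) (vabsV ultra) => h; split=> //.
  apply: contraNneq h => ->; by rewrite (vabs0 ultra) mul0r expr0n eqn0Ngt k0.
have [z0 z0A] := annulus_nonempty.
have [u0 v0 _] := fuv z0 z0A.
have [mu [nu hmu]] := rigid_holomorphic_growth AU hu z0A u0.
have [mv [nv hmv]] := rigid_holomorphic_growth AU hv z0A v0.
(* One y serves both u and v; the successor ensures n > 0. *)
pose n := (maxn nu nv).+1.
have [y yT] := C_has_nth_root T (isT : (0 < n)%N).
have [z1A z2A u1 u2] := hmu n y (leqW (leq_maxl _ _)) yT.
have [_ _ v1 v2] := hmv n y (leqW (leq_maxr _ _)) yT.
set z1 := center + (z0 - center) * y in z1A u1 u2 v1 v2.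
set z2 := center + (z0 - center) * y ^+ 2 in z2A u2 v2.
set t := abs y in u2 v2.
have t1 : 1 < t.
  rewrite -(expr_gt1 (n := n)) //; last exact: vabs_ge0 ultra _.
  by rewrite -(vabsX ultra) yT vabs_T.
have t0 : 0 < t by apply: lt_trans t1.
have r0 := annulus_gt0 z0A.
have zE m : abs (center + (z0 - center) * y ^+ m - center) = abs (z0 - center)
  * t ^+ m.
  by rewrite addrC addKr (vabsM ultra) (vabsX ultra).
have g1 : abs (g z1) = c * (abs (z0 - center) * t) ^ e.
  by rewrite gc // -[z1 - _]/(center + (z0 - center) * y ^+ 1 - center) zE.
have g2 : abs (g z2) = c * (abs (z0 - center) * t ^+ 2) ^ e by rewrite gc // zE.
have [_ _ g1'] := fuv z1 z1A; have [_ _ g2'] := fuv z2 z2A.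
have g12 : abs (g z2) = abs (g z1) * t ^ e.
  rewrite g1 g2 (_ : _ * t ^+ 2 = abs (z0 - center) * t * t).
    by rewrite (expfzMl _ t) mulrA.
  by rewrite expr2 mulrA.
have g1n0 : abs (g z1) != 0.
  by rewrite g1 gt_eqF // mulr_gt0 // exprz_gt0 // mulr_gt0.
have : t ^ e = t ^ ((mu - mv) * k%:Z).
  apply: (mulfI g1n0); rewrite -g12 g2' g1' u2 v2 -exprz_exp -exprnP -exprMn.
  by congr (_ ^+ k); rewrite expfzDr ?gt_eqF // invfM mulrACA invr_expz.
move/(ieexprIz t0 (negbT (gt_eqF t1))) => ->.
exact: dvdz_mull.
Qed.

End Annulus.

(** * The lattice exponential and Delta *)

Section PolynomialPairs.
Variable F : finFieldType.
Local Notation A := {poly F}.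

Lemma mem_polys_lt n (a : A) : (a \in polys_lt F n) = (size a <= n)%N.
Proof.
apply/mapP/idP => [[u _ ->]|an]; first exact: size_poly.
by exists (poly_rV a); rewrite ?mem_enum // poly_rV_K.
Qed.

Lemma uniq_polys_lt n : uniq (polys_lt F n).
Proof. by rewrite map_inj_uniq ?enum_uniq //; exact: can_inj (@rVpolyK _ _).
Qed.

Definition pairs_lt n : seq (A * A) :=
  [seq (a, b) | a <- polys_lt F n, b <- polys_lt F n].

Lemma mem_pairs_lt n (l : A * A) :
  (l \in pairs_lt n) = (size l.1 <= n)%N && (size l.2 <= n)%N.
Proof.
case: l => a b /=; apply/allpairsP/andP => [[[a' b'] /= [ha hb [-> ->]]]|[ha
  hb]].
  by rewrite !mem_polys_lt in ha hb.
by exists (a, b); rewrite !mem_polys_lt.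
Qed.

Lemma uniq_pairs_lt n : uniq (pairs_lt n).
Proof. by apply: allpairs_uniq => [||[a b] [c d] _ _ //]; exact: uniq_polys_lt.
Qed.

(** Each polynomial has a unique such form, u being its constant coefficient. So the polynomials of
    degree at most n fall into q copies of those of degree less than n. *)
Definition sh (u : F) (a : A) : A := a * 'X + u%:P.

Lemma size_sh u a n : (size (sh u a) <= n.+1)%N = (size a <= n)%N.
Proof.
rewrite /sh size_MXaddC; case: eqP => [->|_] //=; rewrite size_poly0.
by case: eqP => _ //=; rewrite ltnS leq0n.
Qed.

Lemma sh_inj u v a b : sh u a = sh v b -> u = v /\ a = b.
Proof.
move=> h; have uv : u = v.
  by have := congr1 (fun p : A => p`_0) h; rewrite !coefD !coefMX !coefC !add0r.
split=> //; move: h; rewrite uv => /addIr; apply: mulIf.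
by rewrite polyX_eq0.
Qed.

Lemma sh0 a : sh 0 a = a * 'X. Proof. by rewrite /sh addr0. Qed.

Lemma shP (a : A) : exists u b, a = sh u b.
Proof. by elim/poly_ind: a => [|b u _]; [exists 0, 0;
  rewrite sh0 mul0r|exists u, b]. Qed.

Lemma perm_polys_ltS n :
  perm_eq (polys_lt F n.+1) [seq sh u a | u <- enum F, a <- polys_lt F n].
Proof.
apply: uniq_perm; first exact: uniq_polys_lt.
  apply: allpairs_uniq; rewrite ?enum_uniq ?uniq_polys_lt // => -[u a] [v b] _
    _ /=.
  by case/sh_inj => -> ->.
move=> a; rewrite mem_polys_lt; apply/idP/allpairsP.
  have [u [b ->]] := shP a; rewrite size_sh => bn; exists (u, b).
  by rewrite mem_enum mem_polys_lt.
by case=> -[u b] /= [_]; rewrite mem_polys_lt => bn ->; rewrite size_sh.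
Qed.

Definition sh2 (u : F * F) (l : A * A) : A * A := (sh u.1 l.1, sh u.2 l.2).

Lemma perm_pairs_ltS n :
  perm_eq (pairs_lt n.+1) [seq sh2 u l | u <- enum {: F * F}, l <- pairs_lt n].
Proof.
apply: uniq_perm; first exact: uniq_pairs_lt.
  apply: allpairs_uniq; rewrite ?enum_uniq ?uniq_pairs_lt //.
  by move=> [[u u'] [a a']] [[v v'] [b b']] _ _ [/sh_inj[-> ->] /sh_inj[-> ->]].
case=> a b; rewrite mem_pairs_lt /=; apply/idP/allpairsP.
  have [u [a' ->]] := shP a; have [v [b' ->]] := shP b; rewrite !size_sh => abn.
  by exists ((u, v), (a', b')); rewrite mem_enum mem_pairs_lt.
case=> -[[u v] [a' b']] /= [_]; rewrite mem_pairs_lt => abn [-> ->].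
by rewrite !size_sh.
Qed.

Lemma sh2_eq0 u l : (sh2 u l == 0) = (u == 0) && (l == 0).
Proof.
case: u l => u v [a b]; apply/eqP/andP => [h|[/eqP[-> ->] /eqP[-> ->]]].
  have /pair_equal_spec[/= ha hb] : sh2 (u, v) (a, b) = sh2 0 0.
    by rewrite h /sh2 /= !sh0 !mul0r.
  by have [-> ->] := sh_inj ha; have [-> ->] := sh_inj hb.
by rewrite /sh2 /= !sh0 !mul0r.
Qed.

Lemma big_pairs_ltS (V : Type) (idx : V) (op : Monoid.com_law idx) n
    (f : A * A -> V) :
  \big[op/idx]_(l <- pairs_lt n.+1) f l =
  \big[op/idx]_(u : F * F) \big[op/idx]_(l <- pairs_lt n) f (sh2 u l).
Proof.
rewrite (perm_big _ (perm_pairs_ltS n)) big_allpairs_dep /=.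
by rewrite big_enum.
Qed.

Lemma big_polys_ltS (V : Type) (idx : V) (op : Monoid.com_law idx) n (f : A ->
  V) :
  \big[op/idx]_(a <- polys_lt F n.+1) f a =
  \big[op/idx]_(u : F) \big[op/idx]_(a <- polys_lt F n) f (sh u a).
Proof.
by rewrite (perm_big _ (perm_polys_ltS n)) big_allpairs_dep /= big_enum.
Qed.

Lemma big_pairs_lt (V : Type) (idx : V) (op : Monoid.com_law idx) n
    (f : A * A -> V) :
  \big[op/idx]_(l <- pairs_lt n) f l =
  \big[op/idx]_(a <- polys_lt F n) \big[op/idx]_(b <- polys_lt F n) f (a, b).
Proof. by rewrite big_allpairs. Qed.

Lemma perm_pairs_lt_sub n m : (n <= m)%N ->
  perm_eq [seq l <- pairs_lt m | l \in pairs_lt n] (pairs_lt n).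
Proof.
move=> nm; apply: uniq_perm; rewrite ?filter_uniq ?uniq_pairs_lt // => l.
rewrite mem_filter !mem_pairs_lt; apply: andb_idr => /andP[h1 h2].
by rewrite (leq_trans h1) // (leq_trans h2).
Qed.

Lemma perm_pairs_lt_add n m : m \in pairs_lt n ->
  perm_eq [seq l + m | l <- pairs_lt n] (pairs_lt n).
Proof.
move=> mn; have addn l k : l \in pairs_lt n -> k \in pairs_lt n -> l + k \in
  pairs_lt n.
  rewrite !mem_pairs_lt => /andP[l1 l2] /andP[k1 k2].
  by rewrite !(leq_trans (size_polyD _ _)) // geq_max ?l1 ?l2.
have oppn l : l \in pairs_lt n -> - l \in pairs_lt n.
  by rewrite !mem_pairs_lt /= !size_polyN.
apply: uniq_perm; rewrite ?map_inj_uniq ?uniq_pairs_lt //; first exact: addIr.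
move=> l; apply/mapP/idP => [[k kn ->]|ln]; first exact: addn.
by exists (l - m); rewrite ?subrK // addn ?oppn.
Qed.

Lemma pairs_lt0 n : 0 \in pairs_lt n.
Proof. by rewrite mem_pairs_lt /= size_poly0. Qed.

End PolynomialPairs.

(** * Truncated exponentials of A z + A and the polynomial phi_T *)

Section Lattice.
Variables (R : realType) (F : finFieldType) (C : C_infty R F).

Local Notation q := #|F|.
Local Notation A := {poly F}.
Local Notation abs := (@C_abs R F C).
Local Notation iota := (C_emb C).
Local Notation T := (iota 'X).
Let ultra := C_ultra C.
Let q_gt1R := qR_gt1 R F.
Let q_gt0R := qR_gt0 R F.

Definition lat (z : C) (l : A * A) : C := iota l.1 * z + iota l.2.

(** Discreteness of A z + A in quantitative form: c is a lower bound for the imaginary part of z,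
    tested on F(T) only. *)
Definition separated (c : R) (z : C) : Prop :=
  forall a b : A, a != 0 -> c * abs (iota a) <= abs (iota a * z + iota b).

Lemma qX_unbounded (x : R) : exists n, x < q%:R ^+ n.
Proof.
exists (Num.truncn x).+1; apply: lt_le_trans (Num.Theory.truncnS_gt _) _.
by rewrite -natrX ler_nat ltnW // ltn_expl // q_gt1.
Qed.

Lemma vabs_iota_ge n (a : A) : (n < size a)%N -> q%:R ^+ n <= abs (iota a).
Proof.
move=> na; rewrite vabs_iota; last by rewrite -size_poly_gt0 (leq_ltn_trans _
  na).
by rewrite ler_weXn2l ?(ltW q_gt1R) //; lia.
Qed.

Lemma vabs_iota_le n (a : A) : (size a <= n)%N -> abs (iota a) <= q%:R ^+ n.
Proof.
move=> na; have [->|a0] := eqVneq a 0.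
  by rewrite rmorph0 (vabs0 ultra) exprn_ge0 // ltW.
by rewrite vabs_iota // ler_weXn2l ?(ltW q_gt1R) //; lia.
Qed.

(** If deg a is large, [separated] bounds a z + b from below; otherwise b dominates. The level n
    depends on z only through c and Z, so it serves a whole annulus. *)
Lemma lat_large (c Z B : R) : 0 < c -> exists n, forall z l,
  separated c z -> abs z <= Z -> l \notin pairs_lt F n -> B < abs (lat z l).
Proof.
move=> c0; have [n1 hn1] := qX_unbounded (B / c).
have [n2 hn2] := qX_unbounded (Num.max B (q%:R ^+ n1 * Z)).
exists (maxn n1 n2) => z [a b] sep zZ; rewrite mem_pairs_lt /= negb_and
  -!ltnNge.
have [an1 _|an1 h] := ltnP n1 (size a).
  have a0 : a != 0 by rewrite -size_poly_gt0 (leq_ltn_trans _ an1).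
  apply: lt_le_trans (sep a b a0); rewrite mulrC -ltr_pdivrMr //.
  exact: lt_le_trans hn1 (vabs_iota_ge an1).
have bn2 : (n2 < size b)%N.
  case/orP: h => [|/(leq_ltn_trans (leq_maxr _ _))//].
  by rewrite ltnNge (leq_trans an1) // leq_maxl.
have := lt_le_trans hn2 (vabs_iota_ge bn2); rewrite gt_max => /andP[Bb azb].
rewrite /lat /= (vabsDr ultra) //; apply: le_lt_trans azb.
rewrite (vabsM ultra) ler_pM ?(vabs_ge0 ultra) //.
exact: vabs_iota_le.
Qed.

Section OneLattice.
Variables (z : C) (c : R).
Hypotheses (c0 : 0 < c) (sep : separated c z).

Lemma latD l k : lat z (l + k) = lat z l + lat z k.
Proof. by rewrite /lat /= !rmorphD; ring. Qed.

Lemma lat0 : lat z 0 = 0.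
Proof. by rewrite /lat /= rmorph0 mul0r addr0. Qed.

Lemma lat_eq0 l : (lat z l == 0) = (l == 0).
Proof.
apply/eqP/eqP => [|->]; last exact: lat0.
case: l => a b h; have a0 : a = 0.
  apply/eqP/negPn/negP => a0; have := sep b a0; rewrite -/(lat z (a, b)) h.
  rewrite (vabs0 ultra) leNgt mulr_gt0 // (vabs_gt0 ultra) iota_eq0 //.
move: h; rewrite a0 /lat /= rmorph0 mul0r add0r => /eqP.
by rewrite iota_eq0 => /eqP ->.
Qed.

Lemma lat_inj : injective (lat z).
Proof.
move=> l k lk; apply/eqP; rewrite -subr_eq0 -lat_eq0.
by have := latD (l - k) k; rewrite subrK lk -[X in X = _]add0r => /addIr <-.
Qed.

Lemma lat_sh2 u l : lat z (sh2 u l) = T * lat z l + lat z (u.1%:P, u.2%:P).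
Proof. by rewrite /lat /sh2 /sh /= !rmorphD !rmorphM /=; ring. Qed.

Definition lat_norm n (w : C) : C := \prod_(l <- pairs_lt F n) (lat z l + w).

(** For fixed w', the polynomial N(x + w') - N(x) - N(w') in x, where N is [lat_norm n], has degree
    less than the number of truncated lattice points, yet vanishes at all of them by translation
    invariance. *)
Lemma lat_norm_add n w w' : lat_norm n (w + w') = lat_norm n w + lat_norm n w'.
Proof.
have normL m x : m \in pairs_lt F n -> lat_norm n (lat z m + x) = lat_norm n x.
  move=> mn; rewrite /lat_norm -[RHS](perm_big _ (perm_pairs_lt_add mn))
    big_map.
  by apply: eq_bigr => l _; rewrite latD addrA.
have norm0 : lat_norm n 0 = 0.
  by apply/eqP; rewrite /lat_norm prodf_seq_eq0; apply/hasP; exists 0;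
     rewrite ?pairs_lt0 //= lat0 addr0.
pose p x : {poly C} := \prod_(d <- [seq - (lat z l + x) | l <- pairs_lt F n])
  ('X - d%:P).
have pE x y : (p x).[y] = lat_norm n (x + y).
  rewrite horner_prod big_map; apply: eq_bigr => l _.
  by rewrite hornerXsubC opprK addrC addrA.
pose D := p w' - p 0 - (lat_norm n w')%:P.
suff D0 : D = 0.
  have := congr1 (horner^~ w) D0.
  rewrite horner0 !hornerE /= !pE add0r => /eqP.
  by rewrite addrAC subr_eq0 subr_eq => /eqP <-; rewrite addrC.
have N0 : (0 < size (pairs_lt F n))%N by rewrite -has_predT; apply/hasP;
  exists 0; rewrite ?pairs_lt0.
have sp x : size (p x) = (size (pairs_lt F n)).+1 by rewrite size_prod_XsubC
  size_map.
have lp x : (p x)`_(size (pairs_lt F n)) = 1.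
  by have /monicP := monic_prod_XsubC [seq - (lat z l + x) | l <- pairs_lt F n]
    xpredT id;
     rewrite /lead_coef sp.
apply: (roots_geq_poly_eq0 (rs := [seq lat z l | l <- pairs_lt F n])).
- apply/allP => _ /mapP[m mn ->]; rewrite rootE /D !hornerD !hornerN hornerC
  !pE add0r.
  have -> : lat_norm n (lat z m) = 0 by rewrite -[lat z m]addr0 normL.
  by rewrite [w' + _]addrC normL // subr0 subrr.
- by rewrite map_inj_uniq ?uniq_pairs_lt //; exact: lat_inj.
- rewrite size_map; apply/leq_sizeP => i; rewrite leq_eqVlt => /predU1P[<-|Ni].
    by rewrite !coefB !lp coefC gtn_eqF // subrr subr0.
  by rewrite !coefB !nth_default ?sp // ?subrr // size_polyC;
    case: eqP => //= _; apply: leq_trans Ni.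
Qed.

Lemma lat_norm0 n : lat_norm n 0 = 0.
Proof. by have := lat_norm_add n 0 0; rewrite addr0 -[X in X = _]addr0 =>
  /addrI. Qed.

Lemma lat_normN n w : lat_norm n (- w) = - lat_norm n w.
Proof. by apply/eqP; rewrite -addr_eq0 -lat_norm_add addNr lat_norm0. Qed.

Definition lat_disc n : C := \prod_(l <- pairs_lt F n | l != 0) lat z l.

Lemma lat_disc_neq0 n : lat_disc n != 0.
Proof. by rewrite prodf_seq_neq0; apply/allP => l _; apply/implyP;
  rewrite lat_eq0. Qed.

Definition lexp_ n w : C := w * \prod_(l <- lattice_Az z n | l != 0) (1 - w /
  l).

Lemma lattice_AzE n : lattice_Az z n = [seq lat z l | l <- pairs_lt F n].
Proof. by rewrite /lattice_Az /pairs_lt map_allpairs. Qed.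

Lemma lexp_E n w :
  lexp_ n w = w * \prod_(l <- pairs_lt F n | l != 0) (1 - w / lat z l).
Proof.
by rewrite /lexp_ lattice_AzE big_map; congr (_ * _); apply: eq_bigl => l;
  rewrite lat_eq0.
Qed.

Lemma big_pairs0 n (f : A * A -> C) :
  \prod_(l <- pairs_lt F n) f l = f 0 * \prod_(l <- pairs_lt F n | l != 0) f l.
Proof. by rewrite (bigD1_seq 0) ?pairs_lt0 ?uniq_pairs_lt. Qed.

Lemma lexp_norm n w : lexp_ n w = lat_norm n w / lat_disc n.
Proof.
rewrite -[w in RHS]opprK lat_normN /lat_norm big_pairs0 lat0 add0r (mulNr w)
  opprK.
rewrite lexp_E /lat_disc -mulrA -prodf_div; congr (_ * _).
by apply: eq_bigr => l l0; rewrite mulrBl divff ?lat_eq0.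
Qed.

(** Representatives of the T-division points modulo the lattice. *)
Definition tors (u : F * F) : C := lat z (u.1%:P, u.2%:P) / T.

Lemma lat_tors u l : lat z l + tors u = lat z (sh2 u l) / T.
Proof. by rewrite lat_sh2 mulrDl mulrAC divff ?mul1r ?T_neq0. Qed.

Lemma lexp_tors_neq0 n u : u != 0 -> lexp_ n (tors u) != 0.
Proof.
move=> u0; rewrite lexp_norm mulf_neq0 ?invr_eq0 ?lat_disc_neq0 //.
rewrite prodf_seq_neq0; apply/allP => l _; apply/implyP => _.
by rewrite lat_tors mulf_neq0 ?invr_eq0 ?T_neq0 // lat_eq0 sh2_eq0 (negbTE u0).
Qed.

(** Splitting off constant coefficients writes the lattice points of level n + 1 as T (l + tors u)
    with l of level n. So the products of level n + 1 factor over u, and additivity of [lat_norm]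
    gives the factors 1 + e_n(w) / e_n(tors u). *)
Lemma lexp_T n w : lexp_ n.+1 (T * w) =
  T * lexp_ n w * \prod_(u : F * F | u != 0) (1 + lexp_ n w / lexp_ n (tors u)).
Proof.
have T0 := T_neq0 C.
pose N := size (pairs_lt F n).
have TN : T ^+ N = \prod_(l <- pairs_lt F n) T.
  by rewrite big_const_seq count_predT iter_mulr_1.
(* One factor T fewer, as l = 0 is omitted. *)
have TN1 : T ^+ N / T = \prod_(l <- pairs_lt F n | l != 0) T.
  by rewrite TN big_pairs0 mulrAC divff ?mul1r.
have normT u x : \prod_(l <- pairs_lt F n) (lat z (sh2 u l) + T * x) =
    T ^+ N * lat_norm n (tors u + x).
  rewrite /lat_norm TN -big_split /=.
  by apply: eq_bigr => l _; rewrite addrA lat_tors mulrDr [T * (_ / _)]mulrCA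
    divff // mulr1.
have -> : lexp_ n.+1 (T * w) =
    T ^+ N * lat_norm n w * (\prod_(u : F * F | u != 0) (T ^+ N * lat_norm n
      (tors u + w)))
    / (T ^+ N / T * lat_disc n * \prod_(u : F * F | u != 0) (T ^+ N * lat_norm
      n (tors u))).
  rewrite lexp_norm; congr (_ / _).
    rewrite /lat_norm big_pairs_ltS (bigD1 (0 : F * F)) //= normT {1}/tors.
    rewrite lat0 mul0r add0r; congr (_ * _).
    by apply: eq_bigr => u _; rewrite normT.
  rewrite /lat_disc big_mkcond big_pairs_ltS (bigD1 (0 : F * F)) //=;
    congr (_ * _).
    rewrite big_pairs0 sh2_eq0 !eqxx /= mul1r.
    rewrite TN1 -big_split /=; apply: eq_bigr => l l0.
    by rewrite sh2_eq0 (negbTE l0) andbF /= lat_sh2 lat0 addr0.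
  apply: eq_bigr => u u0; rewrite -[tors u]addr0 -normT.
  by apply: eq_bigr => l _; rewrite sh2_eq0 (negbTE u0) mulr0 addr0.
have TN0 : T ^+ N != 0 by rewrite expf_neq0.
have d0 := lat_disc_neq0 n.
have cancel1 (t x a d X Y : C) : t != 0 -> x != 0 -> d != 0 -> Y != 0 ->
    t * a * X / (t / x * d * Y) = x * (a / d) * (X / Y).
  by move=> t0 x0 d1 Y0; field; rewrite ?t0 ?x0 ?d1 ?Y0.
have cancel2 (t a b d : C) : t != 0 -> d != 0 -> b != 0 ->
    t * (b + a) / (t * b) = 1 + a / d / (b / d).
  by move=> t0 d1 b0; field; rewrite ?t0 ?d1 ?b0.
have N0 u : u != 0 -> lat_norm n (tors u) != 0.
  by move=> u0; apply: contraNneq (lexp_tors_neq0 n u0);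
    rewrite lexp_norm => ->; rewrite mul0r.
rewrite cancel1 //; last first.
  by rewrite prodf_seq_neq0; apply/allP => u _; apply/implyP => u0;
    rewrite mulf_neq0 ?N0.
rewrite -lexp_norm; congr (_ * _); rewrite -prodf_div; apply: eq_bigr => u u0.
by rewrite lat_norm_add !lexp_norm (cancel2 _ _ _ (lat_disc n)) ?N0.
Qed.

Lemma lexp_tail n m w : (n <= m)%N ->
  lexp_ m w = lexp_ n w *
    \prod_(l <- [seq l <- pairs_lt F m | l \notin pairs_lt F n]) (1 - w / lat z
      l).
Proof.
move=> nm; rewrite !lexp_E -mulrA; congr (_ * _).
rewrite (bigID (mem (pairs_lt F n))) /=; congr (_ * _).
  rewrite -[RHS](perm_big _ (perm_pairs_lt_sub F nm)) big_filter_cond.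
  by apply: eq_bigl => l; rewrite andbC.
rewrite big_filter; apply: eq_bigl => l; rewrite andbC.
by apply: andb_idr; apply: contraNneq => ->; rewrite pairs_lt0.
Qed.

Lemma lexp_abs_stable n m w : (n <= m)%N ->
  (forall l, l \notin pairs_lt F n -> abs w < abs (lat z l)) ->
  abs (lexp_ m w) = abs (lexp_ n w).
Proof.
move=> nm wn; rewrite (lexp_tail _ nm) (vabsM ultra) (vabs_prod1B_eq1 ultra)
  ?mulr1 //.
move=> l; rewrite mem_filter => /andP[/wn wl _].
rewrite (vabsM ultra) (vabsV ultra) ltr_pdivrMr ?mul1r //.
exact: le_lt_trans (vabs_ge0 ultra _) wl.
Qed.

Lemma lexpP w : vcvg abs (lexp_^~ w) (lattice_exp (lattice_Az z) w).
Proof.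
suff [L hL] : exists L, vcvg abs (lexp_^~ w) L.
  by rewrite /lattice_exp (vlimE ultra hL).
have [_ _ _ _ complete] := C_inftyP C; apply: complete => e e0.
have [n0 hn0] := lat_large (abs z) (abs w) c0.
(* From level n0 on, |e_n(w)| is constant, hence at most K. Tail factors within eta of 1 then change
   the product by at most e/2. *)
pose K := abs (lexp_ n0 w) + 1.
have K0 : 0 < K by rewrite ltr_wpDl // vabs_ge0 //; exact: ultra.
pose eta := Num.min (2^-1) (e / 2 / K).
have eta0 : 0 < eta by rewrite lt_min invr_gt0 ltr0n !divr_gt0.
have eta1 : eta < 1 by rewrite gt_min invf_lt1 ?ltr1n.
have [n1 hn1] := lat_large (abs z) (abs w / eta) c0.
pose n := maxn n0 n1.
have near m : (n <= m)%N -> abs (lexp_ m w - lexp_ n w) <= e / 2.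
  move=> nm; rewrite (lexp_tail _ nm) -[X in _ - X]mulr1 -mulrBr (vabsM ultra).
  apply: (@le_trans _ _ (K * eta)); last first.
    by rewrite -ler_pdivlMl // mulrC ge_min lexx orbT.
  apply: ler_pM; rewrite ?(vabs_ge0 ultra) //.
    rewrite (lexp_abs_stable (leq_maxl n0 n1)) ?lerDl // => l ln.
    exact: hn0.
  apply: (vabs_prod1B ultra); first by rewrite ltW.
  move=> l; rewrite mem_filter => /andP[ln _].
  have ln1 : l \notin pairs_lt F n1.
    apply: contra ln; rewrite !mem_pairs_lt => /andP[h1 h2].
    by rewrite !(leq_trans _ (leq_maxr n0 n1)).
  have wl := hn1 z l sep (lexx _) ln1.
  rewrite (vabsM ultra) (vabsV ultra) ler_pdivrMr.
    by rewrite mulrC -ler_pdivrMr // ltW.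
  by apply: le_lt_trans wl; rewrite divr_ge0 ?(vabs_ge0 ultra) // ltW.
exists n => m k nm nk; apply: (@le_lt_trans _ _ (e / 2)).
  by have := vabsB_le ultra (near m nm) (near k nk); rewrite opprB addrA subrK.
by rewrite ltr_pdivrMr // ltr_pMr // ltr1n.
Qed.

(** Factors beyond level n have absolute value 1, so |e_m(w)| is constant for m >= n. In particular
    the limit vanishes only if e_n(w) does. *)
Lemma lattice_exp_abs n w :
  (forall l, l \notin pairs_lt F n -> abs w < abs (lat z l)) ->
  abs (lattice_exp (lattice_Az z) w) = abs (lexp_ n w).
Proof.
move=> wn; have hL := lexpP w; set L := lattice_exp _ _ in hL *.
have [L0|L0] := eqVneq L 0; last first.
  have [N hN] := vcvg_abs ultra L0 hL.
  by rewrite -(hN _ (leq_maxr n N)) (lexp_abs_stable (leq_maxl n N)).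
rewrite L0 (vabs0 ultra); apply/esym/eqP/negPn/negP => ln0.
have {ln0} : 0 < abs (lexp_ n w) by rewrite lt0r ln0 (vabs_ge0 ultra).
move=> /hL[N /(_ _ (leq_maxr n N))].
by rewrite L0 subr0 (lexp_abs_stable (leq_maxl n N)) // ltxx.
Qed.

Lemma lattice_exp_tors_neq0 u : u != 0 -> lattice_exp (lattice_Az z) (tors u)
  != 0.
Proof.
move=> u0; have [n hn] := lat_large (abs z) (abs (tors u)) c0.
rewrite -(vabs_gt0 ultra) (@lattice_exp_abs n).
  by rewrite (vabs_gt0 ultra) lexp_tors_neq0.
by move=> l; apply: hn.
Qed.

(** No nonzero lattice point has absolute value below [Num.min c 1]. This provides infinitely many
    values of the exponential for the uniqueness of phi_T. *)
Lemma lattice_exp_abs_small w : abs w < Num.min c 1 ->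
  abs (lattice_exp (lattice_Az z) w) = abs w.
Proof.
rewrite lt_min => /andP[wc w1]; rewrite (@lattice_exp_abs 0).
  rewrite lexp_E big_seq_cond big1 ?mulr1 // => l; rewrite mem_pairs_lt.
  rewrite !leqn0 !size_poly_eq0 => /andP[/andP[/eqP l1 /eqP l2] /negP[]].
  by apply/eqP; case: l l1 l2 => a b /= -> ->.
case=> a b; rewrite mem_pairs_lt /= !leqn0 !size_poly_eq0 /lat /=.
have ge1 (p : A) : p != 0 -> 1 <= abs (iota p).
  by move=> p0; have := @vabs_iota_ge 0 p; rewrite size_poly_gt0 p0 expr0 => ->.
have [-> /= b0|a0 _] := eqVneq a 0.
  by rewrite rmorph0 mul0r add0r (lt_le_trans w1) // ge1.
apply: lt_le_trans (sep b a0); apply: lt_le_trans wc _.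
by rewrite ler_peMr ?ge1 // ltW.
Qed.

(** The signs come from the factors 1 + e(w) / e(tors u) of the functional equation. *)
Definition phiT_roots : seq C :=
  0 :: [seq - lattice_exp (lattice_Az z) (tors u) | u <- enum [pred u : F * F |
    u != 0]].

Definition phiT_lead : C :=
  T * \prod_(u : F * F | u != 0) (lattice_exp (lattice_Az z) (tors u))^-1.

(** The limit of [lexp_T] gives one solution of the functional equation. Any two solutions agree at
    the values e(T^-i), which have distinct absolute values for large i, so they coincide. *)
Lemma drinfeld_phiTE :
  drinfeld_phiT z = phiT_lead *: \prod_(d <- phiT_roots) ('X - d%:P).
Proof.
set P := RHS; have Pe w : lattice_exp (lattice_Az z) (T * w) =
    P.[lattice_exp (lattice_Az z) w].
  apply: (vcvg_unique ultra (vcvg_shift (lexpP (T * w)))).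
  have -> : P.[lattice_exp (lattice_Az z) w] =
      T * lattice_exp (lattice_Az z) w * \prod_(u <- enum [pred u : F * F | u
        != 0])
        (1 - (- lattice_exp (lattice_Az z) w) / lattice_exp (lattice_Az z)
          (tors u)).
    rewrite /P hornerZ horner_prod /phiT_roots big_cons hornerXsubC subr0
      big_map.
    rewrite /phiT_lead -big_enum -!mulrA; congr (_ * _); rewrite mulrCA;
      congr (_ * _).
    rewrite -big_split; apply: eq_big_seq => u; rewrite mem_enum => u0.
    rewrite /= hornerXsubC opprK mulNr opprK mulrDr mulVf
      ?lattice_exp_tors_neq0 //.
    by rewrite addrC mulrC.
  under eq_fun do rewrite lexp_T -big_enum.
  have cT := vcvgM ultra (vcvg_cst ultra T) (lexpP w).
  apply: (vcvgM ultra cT).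
  (* The value 1 at u = 0 makes the denominators converge to a nonzero limit at every index, as
     needed for [vcvg_prod]. *)
  rewrite (_ : (fun n => _) = (fun n => \prod_(u <- enum [pred u : F * F | u !=
    0])
     (1 - (- lexp_ n w) / (if u == 0 then 1 else lexp_ n (tors u)))));
       last first.
    apply/funext => n; apply: eq_big_seq => u; rewrite mem_enum => u0.
    by rewrite (negbTE u0) mulNr opprK.
  rewrite (_ : \prod_(u <- _) _ = \prod_(u <- enum [pred u : F * F | u != 0])
     (1 - (- lattice_exp (lattice_Az z) w) /
      (if u == 0 then 1 else lattice_exp (lattice_Az z) (tors u)))); last first.
    by apply: eq_big_seq => u; rewrite mem_enum => u0; rewrite (negbTE u0).
  apply: (vcvg_prod ultra) => u; apply: (vcvgB ultra (vcvg_cst ultra 1)).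
  apply: (vcvgM ultra).
    have := vcvgB ultra (vcvg_cst ultra 0) (lexpP w); rewrite sub0r.
    by under eq_fun do rewrite sub0r.
  have [u0|u0] := eqVneq u 0.
    by apply: (vcvgV ultra); [rewrite oner_eq0|exact: vcvg_cst ultra 1].
  by apply: (vcvgV ultra); [exact: lattice_exp_tors_neq0|exact: lexpP].
rewrite /drinfeld_phiT; case: xgetP => [Q _ Qe|/(_ P)]; last by case.
apply/eqP; rewrite -subr_eq0; apply/eqP.
have m0 : 0 < Num.min c 1 by rewrite lt_min c0 ltr01.
have [i0 hi0] := qX_unbounded (Num.min c 1)^-1.
pose w i : C := (T ^+ (i0 + i))^-1.
have aw i : abs (w i) = q%:R ^- (i0 + i).
  by rewrite (vabsV ultra) (vabsX ultra) vabs_T.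
have aew i : abs (lattice_exp (lattice_Az z) (w i)) = q%:R ^- (i0 + i).
  rewrite lattice_exp_abs_small aw // invf_plt ?posrE ?exprn_gt0 //.
  apply: lt_le_trans hi0 _.
  by rewrite ler_weXn2l ?(ltW q_gt1R) // leq_addr.
apply: (roots_geq_poly_eq0
  (rs := [seq lattice_exp (lattice_Az z) (w i) | i <- seq.iota 0 (size (Q -
    P))])).
- by apply/allP => _ /mapP[i _ ->]; rewrite rootE hornerD hornerN -Pe -Qe subrr.
- rewrite map_inj_uniq ?iota_uniq // => i j /(congr1 abs); rewrite !aew.
  move/invr_inj; rewrite !exprnP => /(ieexprIz q_gt0R (negbT (gt_eqF q_gt1R)))
    [].
  exact: addnI.
- by rewrite size_map size_iota.
Qed.

(** There are q^2 roots in the list, 0 and one for each nonzero u, so the coefficient of index q^2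
    is the leading one. *)
Lemma Delta_E : Delta z = phiT_lead.
Proof.
rewrite /Delta drinfeld_phiTE coefZ.
have sz : size phiT_roots = (q ^ 2)%N.
  rewrite /= size_map -cardE.
  have := cardC1 (0 : F * F); rewrite card_prod expnS expn1 => h.
  rewrite (eq_card (B := predC1 (0 : F * F))) // h prednK //.
  by rewrite muln_gt0 !(ltnW (q_gt1 F)).
have /monicP := monic_prod_XsubC phiT_roots xpredT id.
by rewrite /lead_coef size_prod_XsubC sz /= => ->; rewrite mulr1.
Qed.

Lemma vabs_Delta n :
    (forall u l, l \notin pairs_lt F n -> abs (tors u) < abs (lat z l)) ->
  abs (Delta z) = q%:R * \prod_(u : F * F | u != 0)
    (q%:R ^+ size (pairs_lt F n) *
     ((\prod_(l <- pairs_lt F n | l != 0) abs (lat z l)) /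
      (\prod_(l <- pairs_lt F n) abs (lat z (sh2 u l))))).
Proof.
move=> hn; rewrite Delta_E /phiT_lead (vabsM ultra) vabs_T (vabs_prod ultra).
congr (_ * _); apply: eq_bigr => u u0.
rewrite (vabsV ultra) (lattice_exp_abs (hn u)) lexp_norm (vabsM ultra) (vabsV
  ultra).
rewrite invfM invrK mulrC (vabs_prod ultra) mulrCA; congr (_ * _).
rewrite /lat_norm (vabs_prod ultra).
under eq_bigr do rewrite lat_tors (vabsM ultra) (vabsV ultra) vabs_T.
rewrite big_split /= big_const_seq count_predT iter_mulr_1 invfM exprVn invrK.
by rewrite mulrC.
Qed.

End OneLattice.
End Lattice.

(** * Counting the exponent of Delta *)

Section ExponentCount.
Variable F : finFieldType.
Local Notation q := #|F|.
Local Notation A := {poly F}.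
Implicit Types (X a b c d : A).

(** [take_poly s] reduces modulo T^s. For nonzero d with [size d <= s] this says that no - b/d lies
    in the inner disc: a b bringing d X + b T^s below [size d] must cancel everything beyond the
    residue. *)
Definition bad X (s : nat) d : bool := (size d <= size (take_poly s (d * X)))%N.

Definition fibre X s a n c : int := \sum_(b <- polys_lt F n) (inner X s (c * a)
  b : nat)%:Z.

(** The product in [vabs_Delta], for the lattice of a z, with every linear factor replaced by its
    exponent on the annulus. *)
Definition expo X s a n : int :=
  \sum_(u : F * F | u != 0)
    (\sum_(l <- pairs_lt F n | l != 0) (inner X s (l.1 * a) l.2 : nat)%:Z
     - \sum_(l <- pairs_lt F n) (inner X s ((sh2 u l).1 * a) (sh2 u l).2 :
       nat)%:Z).

Lemma inner_shift X s d b : inner X s (d * 'X) (b * 'X) = inner X s d b.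
Proof.
rewrite /inner mulf_eq0 polyX_eq0 orbF; have [//|d0 /=] := eqVneq d 0.
have -> : d * 'X * X + b * 'X * 'X^s = (d * X + b * 'X^s) * 'X by ring.
rewrite [size (d * 'X)]size_mulX //.
have [->|p0] := eqVneq (d * X + b * 'X^s) 0; last by rewrite size_mulX // ltnS.
by rewrite mul0r size_poly0 size_poly_gt0 d0.
Qed.

(* Hence the bound n on the degrees has no influence on [expo X s a n]. *)
Lemma inner_sh X s a c b u v : a != 0 -> (size a + size X + s < size c)%N ->
  inner X s (sh u c * a) (sh v b) = inner X s (c * a) b.
Proof.
move=> a0 cbig; have c0 : c != 0 by rewrite -size_poly_gt0 (leq_ltn_trans _
  cbig).
have ssh : size (sh u c) = (size c).+1 by rewrite /sh size_MXaddC (negbTE c0).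
have sh0 : sh u c != 0 by rewrite -size_poly_gt0 ssh.
have a1 : (0 < size a)%N by rewrite size_poly_gt0.
rewrite /inner !mulf_neq0 //= !size_mul // ssh addSn /=.
have -> : sh u c * a * X + sh v b * 'X^s =
    (c * a * X + b * 'X^s) * 'X + (u%:P * a * X + v%:P * 'X^s) by rewrite /sh;
      ring.
set N := c * a * X + _; set e := u%:P * a * X + _.
have se : (size e <= size a + size X + s)%N.
  have h1 (w : F) p : (size (w%:P * p)%R <= size p)%N.
    rewrite (leq_trans (size_polyMleq _ _)) // size_polyC;
      case: (w != 0) => //=.
    by rewrite add0n leq_pred.
  apply: leq_trans (size_polyD _ _) _; rewrite geq_max -mulrA.
  apply/andP; split; apply: leq_trans (h1 _ _) _.
    rewrite (leq_trans (size_polyMleq _ _)) // (leq_trans (leq_pred _)) //.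
    exact: leq_addr.
  by rewrite size_polyXn -[s.+1]add1n leq_add2r (leq_trans a1) // leq_addr.
have sec : (size e <= (size c + size a).-1)%N.
  rewrite (leq_trans se) // (leq_trans (ltnW cbig)) // -subn1 -addnBA //
    leq_addr //.
have sc : (0 < (size c + size a).-1)%N.
  by rewrite -subn1 -addnBA // addn_gt0 size_poly_gt0 c0.
have -> : (size c + size a)%N = (size c + size a).-1.+1 by rewrite prednK //
  addn_gt0 a1 orbT.
rewrite /=; set k := (size c + size a).-1 in sec sc *; rewrite ltnS.
have sNX : (size (N * 'X)%R <= k)%N = (size N < k)%N.
  have [->|N0] := eqVneq N 0; first by rewrite mul0r size_poly0 sc.
  by rewrite size_mulX.
rewrite -sNX; apply/idP/idP => h.
  rewrite -[N * 'X](addrK e) (leq_trans (size_polyD _ _)) //.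
  by rewrite size_polyN geq_max h.
by rewrite (leq_trans (size_polyD _ _)) // geq_max h.
Qed.

Lemma big_polys_lt_sub (V : nmodType) m n (f : A -> V) : (m <= n)%N ->
  (forall c, (m < size c)%N -> f c = 0) ->
  \sum_(c <- polys_lt F n) f c = \sum_(c <- polys_lt F m) f c.
Proof.
move=> mn f0; rewrite (bigID (fun c : A => (size c <= m)%N)) /= [X in _ +
  X]big1.
  rewrite addr0 -big_filter; apply: perm_big; apply: uniq_perm.
  - by rewrite filter_uniq // uniq_polys_lt.
  - exact: uniq_polys_lt.
  move=> c; rewrite mem_filter !mem_polys_lt; apply: andb_idr => h.
  exact: leq_trans mn.
by move=> c; rewrite -ltnNge; apply: f0.
Qed.

(** The terms with u = 0 cancel by [inner_shift], so u may run over all of F^2; those with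
    [size c > m] cancel by [inner_sh]. What remains compares q^2 copies of level n with level n + 1,
    c being bounded in both. *)
Lemma expoE X s a m n : a != 0 -> (size a + size X + s <= m <= n)%N ->
  expo X s a n = (q ^ 2)%N%:Z * \sum_(c <- polys_lt F m) fibre X s a n c
    - \sum_(c <- polys_lt F m.+1) fibre X s a n.+1 c.
Proof.
move=> a0 /andP[am mn]; rewrite /expo.
have inner0 : inner X s (0 : A) 0 = false by rewrite /inner eqxx.
pose g (u : F * F) (l : A * A) : int := (inner X s (l.1 * a) l.2 : nat)%:Z
  - (inner X s ((sh2 u l).1 * a) (sh2 u l).2 : nat)%:Z.
transitivity (\sum_(u : F * F) \sum_(l <- pairs_lt F n) g u l).
  rewrite [RHS](bigD1 (0 : F * F)) //= [X in _ = X + _]big1 ?add0r.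
    apply: eq_bigr => u _; rewrite sumrB; congr (_ - _).
    rewrite [RHS](bigD1_seq 0) ?pairs_lt0 ?uniq_pairs_lt //=.
    by rewrite mul0r inner0 add0r.
  by move=> l _; rewrite /g /sh2 /= !sh0 mulrAC inner_shift subrr.
under eq_bigr do rewrite big_pairs_lt.
rewrite exchange_big /= (big_polys_lt_sub mn); last first.
  move=> c cbig; rewrite big1 // => u _; rewrite big1 // => b _.
  by rewrite /g /sh2 /= inner_sh ?subrr // (leq_ltn_trans am).
rewrite mulr_sumr big_polys_ltS [X in _ = _ - X]exchange_big /= -sumrB;
  apply: eq_bigr => c _.
rewrite /g; under eq_bigr do rewrite sumrB; rewrite sumrB; congr (_ - _).
  rewrite sumr_const -mulr_natl natz; congr (Posz _ * _).
  by rewrite card_prod expnS expn1.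
rewrite -(pair_bigA _ (fun u v => \sum_(b <- polys_lt F n)
  (inner X s (sh u c * a) (sh v b) : nat)%:Z)) /=.
by apply: eq_bigr => u _; rewrite /fibre big_polys_ltS.
Qed.

Lemma perm_polys_lt_add n d : (size d <= n)%N ->
  perm_eq [seq b + d | b <- polys_lt F n] (polys_lt F n).
Proof.
move=> dn; apply: uniq_perm; [|exact: uniq_polys_lt|].
  by rewrite map_inj_uniq ?uniq_polys_lt //; exact: addIr.
move=> b; rewrite mem_polys_lt; apply/mapP/idP => [[b' + ->]|bn].
  by rewrite mem_polys_lt => b'n; rewrite (leq_trans (size_polyD _ _)) //
    geq_max b'n.
exists (b - d); rewrite ?subrK // mem_polys_lt (leq_trans (size_polyD _ _)) //.
by rewrite size_polyN geq_max bn.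
Qed.

(* Subtracting the integral part of [d X / T^s] from b makes the condition
   depend on X only when [size d <= s]. *)
Lemma fibre_formula X s a n c : a != 0 -> (size (c * a * X)%R <= n)%N ->
  fibre X s a n c = \sum_(b <- polys_lt F n)
    ((if (size (c * a)%R <= s)%N then [&& c != 0, b == 0 & ~~ bad X s (c * a)]
      else (size b + s < size (c * a)%R)%N) : nat)%:Z.
Proof.
move=> a0 Xn; set d := c * a in Xn *; rewrite /fibre -/d.
have dX : d * X = take_poly s (d * X) + drop_poly s (d * X) * 'X^s.
  by rewrite poly_take_drop.
set t := take_poly s _ in dX *; set Q := drop_poly s _ in dX.
have st : (size t <= s)%N by exact: size_take_poly.
have Qn : (size (- Q)%R <= n)%N.
  by rewrite size_polyN size_drop_poly (leq_trans (leq_subr _ _)).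
rewrite -(perm_big _ (perm_polys_lt_add Qn)) big_map; apply: eq_bigr => b _.
congr (Posz (nat_of_bool _)).
have -> : inner X s d (b - Q) = (d != 0) && (size (t + b * 'X^s)%R < size d)%N.
  rewrite /inner dX (_ : t + _ + _ = t + b * 'X^s) //; ring.
have -> : (d != 0) = (c != 0) by rewrite mulf_eq0 (negbTE a0) orbF.
have [c0|c0 /=] := eqVneq c 0.
  by rewrite /d c0 mul0r size_poly0 leq0n.
have tb : b != 0 -> size (t + b * 'X^s)%R = (size b + s)%N.
  move=> b0; rewrite addrC size_polyDl size_mulXn // addnC //.
  by rewrite (leq_ltn_trans st) // -{1}[s]add0n ltn_add2r size_poly_gt0.
rewrite /bad -/t; have [ds|ds] := leqP (size d) s.
  have [->|b0] := eqVneq b 0; first by rewrite mul0r addr0 -ltnNge.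
  by rewrite tb // ltnNge (leq_trans ds (leq_addl _ _)).
have [->|b0] := eqVneq b 0; last by rewrite tb.
by rewrite mul0r addr0 size_poly0 add0n ds (leq_ltn_trans st).
Qed.

Definition bad_count X s a m : nat :=
  \sum_(c <- polys_lt F m | c != 0) (((size (c * a)%R <= s)%N && bad X s (c *
    a)) : nat).

(** Only nonzero c with [size (c * a) <= s] feel the center. Their fibre has one element, or none if
    c a is bad, and around 0 nothing is bad. *)
Lemma fibre_diff X s a n c : a != 0 -> (size (c * a * X)%R <= n)%N ->
  fibre 0 s a n c - fibre X s a n c =
  ([&& c != 0, (size (c * a)%R <= s)%N & bad X s (c * a)] : nat)%:Z.
Proof.
move=> a0 Xn; rewrite !fibre_formula ?mulr0 ?size_poly0 //.
case: leqP => cs; last by rewrite subrr andbF.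
have bad0 : c != 0 -> bad 0 s (c * a) = false.
  move=> c0; rewrite /bad mulr0 take_poly0r size_poly0 leqn0 size_poly_eq0.
  by rewrite mulf_eq0 (negbTE c0) (negbTE a0).
have sum1 (e : bool) : \sum_(b <- polys_lt F n) (((b == 0) && e : nat)%:Z) = (e
  : nat)%:Z.
  rewrite (bigD1_seq 0) ?uniq_polys_lt ?mem_polys_lt ?size_poly0 //= eqxx.
  by rewrite big1 ?addr0 // => b /negbTE ->.
have [_|c0 /=] := eqVneq c 0; first by rewrite /= subrr.
by rewrite !sum1 bad0 //; case: bad.
Qed.

Lemma expo_diff X s a : a != 0 -> exists m n0 : nat,
  (0 < m)%N /\ forall n, (n0 <= n)%N ->
  expo 0 s a n - expo X s a n = (q ^ 2 - 1)%N%:Z * (bad_count X s a m)%:Z.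
Proof.
move=> a0; pose m := (size a + size X + s)%N.
exists m, (m.+1 + size a + size X)%N; split=> [|n n0n].
  by rewrite /m -addnA addn_gt0 size_poly_gt0 a0.
have mn : (m <= n)%N by rewrite (leq_trans _ n0n) // -addnA leqW // leq_addr.
rewrite !(@expoE _ _ _ m) ?mn ?andbT //; last by rewrite size_poly0 addn0
  leq_add2r leq_addr.
have diff k p : (k <= m.+1)%N -> (n <= p)%N ->
    \sum_(c <- polys_lt F k) fibre 0 s a p c - \sum_(c <- polys_lt F k) fibre X
      s a p c =
    \sum_(c <- polys_lt F k) ([&& c != 0, (size (c * a)%R <= s)%N & bad X s (c
      * a)] : nat)%:Z.
  move=> km np; rewrite -sumrB; apply: eq_big_seq => c;
    rewrite mem_polys_lt => ck.
  apply: fibre_diff => //; apply: leq_trans np; apply: leq_trans n0n.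
  apply: leq_trans (size_polyMleq _ _) _; apply: leq_trans (leq_pred _) _.
  rewrite leq_add2r; apply: leq_trans (size_polyMleq _ _) _.
  by apply: leq_trans (leq_pred _) _; rewrite leq_add2r (leq_trans ck).
have -> : forall x y z w t : int, x * y - z - (x * w - t) = x * (y - w) - (z -
  t).
  by move=> *; ring.
(* A nonzero c with [size (c * a) <= s] has size at most s <= m, so levels m and m + 1 give the same
   count and the coefficients combine to q^2 - 1. *)
rewrite !diff // (@big_polys_lt_sub _ m m.+1) //; last first.
  move=> c cm; case: eqP => //= /eqP c0; case: leqP => //= cs.
  have : (size c <= s)%N.
    apply: leq_trans cs; rewrite size_mul // -subn1 -addnBA ?size_poly_gt0 //.
    exact: leq_addr.
  by rewrite leqNgt (leq_ltn_trans _ cm) // leq_addl.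
rewrite -{2}[\sum_(c <- _) _]mul1r -mulrBl; congr (_ * _).
  by rewrite -subzn // expn_gt0 (ltnW (q_gt1 F)).
rewrite /bad_count big_mkcond /=.
elim: (polys_lt F m) => [|c r IH]; first by rewrite !big_nil.
by rewrite !big_cons IH; case: (c != 0).
Qed.

(** Group by leading coefficient: scaling by v matches the monic polynomials with those of leading
    coefficient v. *)
Lemma sum_scale_invariant (f : A -> nat) m :
    (forall (v : F) c, v != 0 -> f (v *: c) = f c) ->
  (\sum_(c <- polys_lt F m | c != 0%R) f c =
   (q - 1) * \sum_(c <- polys_lt F m | c \is monic) f c)%N.
Proof.
move=> fZ.
rewrite (eq_bigr (fun c => \sum_(v : F | v == lead_coef c) f c)%N); last first.
  by move=> c _; rewrite big_pred1_eq.
rewrite (exchange_big_dep (fun v : F => v != 0)) /=; last first.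
  by move=> c v c0 /eqP ->; rewrite lead_coef_eq0.
rewrite (eq_bigr (fun=> \sum_(c <- polys_lt F m | c \is monic) f c)%N).
  rewrite sum_nat_const -[#|_|]/(#|predC1 (0 : F)|) cardC1 subn1;
    congr (_ * _)%N.
move=> v v0; have pv : perm_eq [seq v *: c | c <- polys_lt F m] (polys_lt F m).
  apply: uniq_perm; [|exact: uniq_polys_lt|].
    by rewrite map_inj_uniq ?uniq_polys_lt //; exact: scalerI.
  move=> c; rewrite mem_polys_lt; apply/mapP/idP => [[c' + ->]|cm].
    by rewrite mem_polys_lt size_scale.
  exists (v^-1 *: c); last by rewrite scalerA divff // scale1r.
  by rewrite mem_polys_lt size_scale ?invr_eq0.
rewrite -(perm_big _ pv) big_map; apply: eq_big => [c|c _]; last exact: fZ.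
rewrite scaler_eq0 (negbTE v0) /= lead_coefZ monicE -{1}[v]mulr1.
rewrite (inj_eq (mulfI v0)) [1 == _]eq_sym; apply: andb_idl.
by apply: contraTneq => ->; rewrite lead_coef0 eq_sym oner_eq0.
Qed.

Definition monic_bad_count X s a m : nat :=
  \sum_(c <- polys_lt F m | c \is monic) (((size (c * a)%R <= s)%N && bad X s
    (c * a)) : nat).

Lemma bad_countE X s a m : bad_count X s a m = ((q - 1) * monic_bad_count X s a
  m)%N.
Proof.
apply: sum_scale_invariant => v c v0; rewrite /bad -!scalerAl.
by rewrite take_polyZ !size_scale.
Qed.

Lemma monic_bad_count_gt X s a m : (s < size a)%N -> monic_bad_count X s a m =
  0%N.
Proof.
move=> sa; rewrite /monic_bad_count big1 // => c mc.
have a0 : a != 0 by rewrite -size_poly_gt0 (leq_ltn_trans _ sa).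
rewrite mulrC size_Mmonic // [(_ <= s)%N]leqNgt (leq_trans sa) //.
by rewrite -subn1 -addnBA ?size_poly_gt0 ?monic_neq0 // leq_addr.
Qed.

(** A monic c of positive degree makes c a too large, which leaves c = 1. *)
Lemma monic_bad_count_eq X s a m : (0 < m)%N -> (0 < s)%N -> size a = s ->
  monic_bad_count X s a m = bad X s a.
Proof.
move=> m0 s0 sa; have a0 : a != 0 by rewrite -size_poly_gt0 sa.
rewrite /monic_bad_count big_mkcond.
rewrite (bigD1_seq (1 : A)) ?uniq_polys_lt ?mem_polys_lt ?size_poly1 //=.
rewrite monic1 mul1r sa leqnn /= big1 ?addn0 // => c c1; case: ifP => // mc.
suff -> : (size (c * a)%R <= s)%N = false by [].
apply: contraNF c1; rewrite mulrC size_Mmonic // sa -subn1 -addnBA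
  ?size_poly_gt0 ?monic_neq0 //.
rewrite -{2}[s]addn0 leq_add2l leqn0 subn_eq0 => /size1_polyC Dc.
by move: mc; rewrite Dc monicE lead_coefC => /eqP ->.
Qed.

(** The residue modulo T^(s+1) has size at most s + 1, so only its top coefficient matters. *)
Lemma bad_top X s a : size a = s.+1 -> bad X s.+1 a = ((a * X)`_s != 0).
Proof.
move=> sa; rewrite /bad sa; apply/idP/idP => [h|].
  have st : size (take_poly s.+1 (a * X)) = s.+1.
    by apply/eqP; rewrite eqn_leq h size_take_poly.
  have : lead_coef (take_poly s.+1 (a * X)) != 0.
    by rewrite lead_coef_eq0 -size_poly_gt0 st.
  by rewrite lead_coefE st coef_take_poly ltnS leqnn.
apply: contraR; rewrite -ltnNge ltnS => h.
by have := nth_default 0 h; rewrite coef_take_poly ltnS leqnn => ->.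
Qed.

End ExponentCount.

(** * Divisors of the level and the theorem *)

Section DeltaExponent.
Variables (R : realType) (F : finFieldType) (C : C_infty R F).

Local Notation q := #|F|.
Local Notation A := {poly F}.
Local Notation abs := (@C_abs R F C).
Local Notation iota := (C_emb C).
Local Notation T := (iota 'X).
Let ultra := C_ultra C.
Let q_gt1R := qR_gt1 R F.
Let q_gt0R := qR_gt0 R F.

Lemma lat_scale (a : A) (z : C) l :
  lat (iota a * z) l = iota (l.1 * a) * z + iota l.2.
Proof. by rewrite /lat rmorphM mulrA. Qed.

Lemma separated_annulus X s (a : A) (z : C) : a != 0 -> annulus X s z ->
  separated (abs (iota a) * q%:R ^- s.+1) (iota a * z).
Proof.
move=> a0 zA c b c0; rewrite -/(lat _ (c, b)) lat_scale /= (vabs_linear _ _ zA)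
  ?mulf_neq0 //.
rewrite rmorphM (vabsM ultra) mulrAC [abs (iota c) * _]mulrC.
rewrite ler_wpM2l ?mulr_ge0 ?(vabs_ge0 ultra) // le_max.
by case/andP: zA => /ltW ->.
Qed.

(** [vabs_Delta] needs a level beyond which all lattice points exceed the torsion points; the bounds
    on both are uniform on the annulus, so one level works for all z. *)
Lemma monomial_Delta X s (a : A) : a != 0 -> exists n0, forall n, (n0 <= n)%N ->
  monomial X s (fun z : C => abs (Delta (iota a * z))) (expo X s a n).
Proof.
move=> a0; have ia0 : 0 < abs (iota a) by rewrite (vabs_gt0 ultra) iota_eq0.
pose c := abs (iota a) * q%:R ^- s.+1.
have c0 : 0 < c by rewrite mulr_gt0 // invr_gt0 exprn_gt0.
pose Z := abs (iota a) * q%:R ^+ size X.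
have aZ z : annulus X s z -> abs (iota a * z) <= Z.
  by move=> zA; rewrite (vabsM ultra) ler_pM2l // (vabs_annulus_le zA).
have [n0 hn0] := @lat_large R F C c Z (Z + 1) c0.
exists n0 => n n0n.
have sub l : l \notin pairs_lt F n -> l \notin pairs_lt F n0.
  apply: contra; rewrite !mem_pairs_lt => /andP[h1 h2].
  by rewrite (leq_trans h1) // (leq_trans h2).
have torsB z u : annulus X s z -> abs (tors (iota a * z) u) <= Z + 1.
  move=> zA; have Z0 : 0 <= Z by apply: le_trans (aZ z zA);
    exact: vabs_ge0 ultra _.
  rewrite /tors (vabsM ultra) (vabsV ultra) vabs_T ler_pdivrMr //.
  apply: (@le_trans _ _ (Z + 1)); last by rewrite ler_peMr ?addr_ge0 // ltW.
  apply: (vabsD_le ultra); last by rewrite (le_trans (vabs_iotaC_le _ _)) //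
    lerDr.
  rewrite (vabsM ultra); apply: (@le_trans _ _ (1 * Z));
    last by rewrite mul1r lerDl.
  by apply: ler_pM; rewrite ?(vabs_ge0 ultra) ?vabs_iotaC_le ?aZ.
have DE z : annulus X s z -> q%:R * \prod_(u : F * F | u != 0)
    (q%:R ^+ size (pairs_lt F n) *
     ((\prod_(l <- pairs_lt F n | l != 0) abs (iota (l.1 * a) * z + iota l.2)) *
      (\prod_(l <- pairs_lt F n) abs (iota ((sh2 u l).1 * a) * z + iota (sh2 u
        l).2))^-1))
    = abs (Delta (iota a * z)).
  move=> zA; rewrite (@vabs_Delta _ _ _ _ _ c0 (separated_annulus a0 zA) n).
    congr (_ * _); apply: eq_bigr => u _; congr (_ * (_ / _)).
      by apply: eq_bigr => l _; rewrite lat_scale.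
    by apply: eq_bigr => l _; rewrite lat_scale.
  move=> u l ln; apply: le_lt_trans (torsB z u zA) _.
  exact: hn0 _ _ (separated_annulus a0 zA) (aZ z zA) (sub l ln).
apply: eq_monomial DE _.
rewrite -[expo _ _ _ _]add0r; apply: monomialM; first exact: monomial_cst.
apply: monomial_prod => u _ u0.
rewrite -[X in monomial _ _ _ X]add0r; apply: monomialM.
  by apply: monomial_cst; rewrite exprn_gt0.
have lin (l : A * A) : l != 0 -> monomial X s
    (fun z : C => abs (iota (l.1 * a) * z + iota l.2)) (inner X s (l.1 * a) l.2
      : nat).
  move=> l0; apply: monomial_linear; rewrite mulf_eq0 (negbTE a0) orbF.
  by rewrite -negb_and; apply: contra l0; case: l => x y /= /andP[/eqP -> /eqP
    ->].
apply: monomialM; first by apply: monomial_prod => l _; exact: lin.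
apply: monomialV; apply: monomial_prod => l _ _; apply: lin.
by rewrite sh2_eq0 (negbTE u0).
Qed.

(** The exponents of the Delta quotient on the annuli around 0 and X/T^s are both divisible by k. In
    their difference each divisor enters only through its bad count, by [expo_diff]. *)
Lemma root_exponents_congruence (n : A) (r : A -> int) (k : nat) X s :
    (0 < k)%N -> has_modular_root n k (@Delta_quotient R F C n r) ->
  exists2 m : A -> nat, forall a, (0 < m a)%N &
    (k %| \sum_(a <- monic_divisors n)
       ((q - 1) * (q ^ 2 - 1))%N%:Z * r a * (monic_bad_count X s a (m a))%:Z)%Z.
Proof.
move=> k0 [f [mero _ _] fk].
have /choice[mE hE] : forall a : A, exists mE : nat * (int * int), (0 < mE.1)%N
  /\ (a != 0 ->
    [/\ monomial 0 s (fun z : C => abs (Delta (iota a * z))) mE.2.1,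
        monomial X s (fun z : C => abs (Delta (iota a * z))) mE.2.2 &
        mE.2.1 - mE.2.2 = ((q - 1) * (q ^ 2 - 1))%N%:Z * (monic_bad_count X s a
          mE.1)%:Z]).
  move=> a; have [->|a0] := eqVneq a 0; first by exists (1%N, (0, 0)).
  have [m [n1 [m0 h1]]] := expo_diff X s a0.
  have [n2 h2] := monomial_Delta 0 s a0; have [n3 h3] := monomial_Delta X s a0.
  (* A level valid for both annuli and for the difference formula. *)
  pose N := maxn n1 (maxn n2 n3).
  exists (m, (expo 0 s a N, expo X s a N)); split=> //= _; split.
  - by apply: h2; rewrite /N !leq_max leqnn orbT.
  - by apply: h3; rewrite /N !leq_max leqnn !orbT.
  - rewrite h1 ?leq_max ?leqnn // bad_countE !PoszM; ring.
exists (fun a => (mE a).1) => [a|]; first exact: (hE a).1.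
have div0 a : a \in monic_divisors n -> a != 0.
  by rewrite mem_filter => /andP[/andP[/monic_neq0]].
have slope Y (e : A -> int) : (forall a, a != 0 ->
      monomial Y s (fun z : C => abs (Delta (iota a * z))) (e a)) ->
    (k %| \sum_(a <- monic_divisors n) e a * r a)%Z.
  move=> he; apply: (root_exponent_dvd k0 mero fk).
  apply: (@eq_monomial _ _ _ _ _
    (fun z => \prod_(a <- monic_divisors n) abs (Delta (iota a * z)) ^ r a)).
    move=> z _; rewrite /Delta_quotient (vabs_prod ultra);
      apply: eq_bigr => a _.
    by case: (r a) => i; rewrite /exprz ?(vabsV ultra) (vabsX ultra).
  by apply: monomial_prod => a /div0 a0 _; apply: monomialXz; apply: he.
have := rpredB (slope 0 (fun a => (mE a).2.1) (fun a a0 => let: And3 h _ _ :=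
  (hE a).2 a0 in h))
  (slope X (fun a => (mE a).2.2) (fun a a0 => let: And3 _ h _ := (hE a).2 a0 in
    h)).
rewrite -sumrB; congr (_ %| _)%Z; apply: eq_big_seq => a /div0 a0.
by rewrite -mulrBl; have [_ _ ->] := (hE a).2 a0; ring.
Qed.

End DeltaExponent.

(** * Monic divisors of prime powers and of products of two primes *)

Section SpecialLevel.
Variable F : finFieldType.
Local Notation A := {poly F}.
Implicit Types (n m d : A).

(* Two distinct monic polynomials of the same degree are separated by a linear
   form; this is where the shape of n matters, as three monic divisors of n of
   the same degree might be linearly dependent. *)
Definition separable_divisors n : Prop := forall m, m \is monic -> m %| n ->
  exists2 X : A, (m * X)`_(size m).-1 != 0 &
    forall d, d \is monic -> d %| n -> size d = size m -> d != m ->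
      (d * X)`_(size m).-1 = 0.

(** Pick an index i below the top degree D at which the only competitor d differs from m. For X =
    T^(D-i) - d_i and e monic of degree D, the coefficient of T^D in e X is e_i - d_i, which
    vanishes for e = d but not for e = m. *)
Lemma separable_divisors_le2 n :
  (forall m, m \is monic -> m %| n -> exists d0, forall d, d \is monic -> d %|
    n ->
     size d = size m -> d != m -> d = d0) -> separable_divisors n.
Proof.
move=> h m mm mn; have [d0 hd0] := h m mm mn.
have sm : (0 < size m)%N by rewrite size_poly_gt0 monic_neq0.
have top d : d \is monic -> size d = size m -> d`_(size m).-1 = 1.
  by move=> /monicP + <-; rewrite lead_coefE.
have [[d [md dn sd dm]]|none] := pselect (exists d, [/\ d \is monic, d %| n,
  size d = size m & d != m]);
  last first.
  exists 1; first by rewrite mulr1 top ?oner_eq0.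
  by move=> d *; case: none; exists d.
have [i im hi] : exists2 i, (i < (size m).-1)%N & d`_i != m`_i.
  apply: contrapT => h'; case/eqP: dm; apply/polyP => i.
  have [ism|] := ltnP i (size m); last by move=> ism; rewrite !nth_default ?sd.
  have [im|] := ltnP i (size m).-1.
    by apply/eqP/negPn/negP => hi; apply: h'; exists i.
  move=> mi; have -> : i = (size m).-1; last by rewrite !top.
  by apply/eqP; rewrite eqn_leq mi andbT -ltnS prednK.
pose D := (size m).-1.
have coefX e : (e * ('X^(D - i) - (d`_i)%:P))`_D = e`_i - e`_D * d`_i.
  by rewrite mulrBr coefB coefMXn coefMC ltnNge leq_subr /= subKn // ltnW.
exists ('X^(D - i) - (d`_i)%:P); first by rewrite coefX top // mul1r subr_eq0
  eq_sym.
move=> e me en se em; rewrite (hd0 e) // -(hd0 d) // coefX top //.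
by rewrite mul1r subrr.
Qed.

Lemma prime_dvdp_or_coprime p d : prime_poly p -> p %| d \/ coprimep p d.
Proof.
move=> [_ [_ irr]]; have [|nc] := boolP (coprimep p d); first by right.
left; have /irr : size (gcdp p d) != 1%N := nc.
by move=> /(_ (dvdp_gcdl p d)) /eqp_dvdl <-; exact: dvdp_gcdr.
Qed.

Lemma monic_dvdp1 d : d \is monic -> d %| 1 -> d = 1.
Proof.
move=> md; rewrite dvdp1 => /eqP sd; have /size1_polyC Dd : (size d <= 1)%N by
  rewrite sd.
by move: md; rewrite Dd monicE lead_coefC => /eqP ->.
Qed.

Lemma monic_dvdp_prime p d : prime_poly p -> d \is monic -> d %| p -> d = 1 \/
  d = p.
Proof.
move=> [mp [_ irr]] md dp; have [sd|sd] := eqVneq (size d) 1%N.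
  by left; apply: monic_dvdp1 => //; rewrite dvdp1 sd.
by right; apply/eqP; rewrite -eqp_monic //; exact: irr.
Qed.

Lemma monic_dvdp_factor p d n : prime_poly p -> d \is monic -> p %| d -> d %| p
  * n ->
  exists2 d', d = p * d' & d' \is monic /\ d' %| n.
Proof.
move=> [mp _] md /dvdpP[d' Dd] dn; exists d'; first by rewrite mulrC.
have p0 := monic_neq0 mp; split; first by move: md; rewrite Dd monicMr.
by move: dn; rewrite Dd mulrC dvdp_mul2l.
Qed.

Lemma monic_dvdp_primepower p e d : prime_poly p -> d \is monic -> d %| p ^+ e
  ->
  exists i, d = p ^+ i.
Proof.
move=> pp; elim: e d => [|e IH] d md.
  by rewrite expr0 => /(monic_dvdp1 md) ->; exists 0%N.
rewrite exprS => dn; have [pd|cpd] := prime_dvdp_or_coprime d pp.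
  have [d' -> [md' /(IH _ md')[i ->]]] := monic_dvdp_factor pp md pd dn.
  by exists i.+1; rewrite exprS.
by apply: IH => //; move: dn; rewrite Gauss_dvdpr // coprimep_sym.
Qed.

(** Distinct powers of p have distinct degrees, so m has no competitor. *)
Lemma separable_divisors_primepower p e : prime_poly p -> separable_divisors (p
  ^+ e).
Proof.
move=> pp; have [mp [p1 _]] := pp; apply: separable_divisors_le2 => m mm mn;
  exists m => d md dn + _.
have [i ->] := monic_dvdp_primepower pp md dn.
have [j ->] := monic_dvdp_primepower pp mm mn.
have sX l : size (p ^+ l) = (l * (size p).-1).+1.
  by rewrite -[LHS]prednK ?size_poly_gt0 ?expf_neq0 ?monic_neq0 // size_exp
    mulnC.
rewrite !sX => -[] /eqP; rewrite eqn_mul2r -subn1 subn_eq0 leqNgt p1 /=.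
by move=> /eqP ->.
Qed.

(** Among 1, p, p' and p p' only p and p' can have equal degree, so each m has at most one
    competitor. *)
Lemma separable_divisors_pq p p' : prime_poly p -> prime_poly p' -> p <> p' ->
  separable_divisors (p * p').
Proof.
move=> pp pp' pp'n; have [mp [p1 _]] := pp; have [mp' [p1' _]] := pp'.
have div4 d : d \is monic -> d %| p * p' -> [\/ d = 1, d = p, d = p' | d = p *
  p'].
  move=> md dn; have [pd|cpd] := prime_dvdp_or_coprime d pp.
    have [d' -> [md' /(monic_dvdp_prime pp' md')]] := monic_dvdp_factor pp md
      pd dn.
    by case=> ->; rewrite ?mulr1; constructor.
  have : d %| p' by move: dn; rewrite Gauss_dvdpr // coprimep_sym.
  by case/(monic_dvdp_prime pp' md) => ->; constructor.
have spp : size (p * p') = (size p + size p').-1 by rewrite size_Mmonic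
  ?monic_neq0.
apply: separable_divisors_le2 => m mm mn; exists (if m == p then p' else p).
(* Sizes of the form u + 2 record that primes are not constant, which lets arithmetic discard the
   other coincidences of degree. *)
have [u su] : exists u, size p = u.+2 by case: (size p) p1 => [|[|u]] // _;
  exists u.
have [v sv] : exists v, size p' = v.+2 by case: (size p') p1' => [|[|v]] // _;
  exists v.
rewrite su sv in spp; move=> d md dn.
case: (div4 m mm mn) => ->; case: (div4 d md dn) => ->;
  rewrite ?eqxx ?spp ?size_poly1 ?su ?sv //; clear; try by lia.
  by move=> _ _; case: eqP => [->|].
Qed.

End SpecialLevel.

Theorem theorem1p6 (R : realType) (F : finFieldType) (C : C_infty R F)
    (n : {poly F})
    (hn : (exists (p : {poly F}) (e : nat),
             [/\ prime_poly p, (1 <= e)%N & n = p ^+ e]) \/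
          (exists p p' : {poly F},
             [/\ prime_poly p, prime_poly p', p <> p' & n = p * p']))
    (r : {poly F} -> int) (k : nat) (hk : (0 < k)%N)
    (hroot : has_modular_root n k (@Delta_quotient R F C n r)) :
  (forall a : {poly F}, a \is monic -> a %| n ->
     exists m : int,
       (r a)%:~R / k%:R = m%:~R / ((#|F| - 1) * (#|F| ^ 2 - 1))%:R :> rat) /\
  (\big[gcdn/0%N]_(a <- monic_divisors n) `|r a|%N = 1%N ->
     (k %| (#|F| - 1) * (#|F| ^ 2 - 1))%N).
Proof.
have [n0 sepn] : n != 0 /\ separable_divisors n.
  case: hn => [[p [e [pp _ ->]]]|[p [p' [pp pp' npp ->]]]].
    split; last exact: separable_divisors_primepower.
    by rewrite expf_neq0 // monic_neq0; case: pp.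
  split; last exact: separable_divisors_pq.
  by rewrite mulf_neq0 // monic_neq0 //; [case: pp|case: pp'].
set N := ((#|F| - 1) * (#|F| ^ 2 - 1))%N.
have N0 : (0 < N)%N.
  by rewrite muln_gt0 !subn_gt0 q_gt1 (leq_trans (q_gt1 F)) // expnS expn1
    leq_pmulr // ltnW // q_gt1.
have mem_div a : (a \in monic_divisors n) = (a \is monic) && (a %| n).
  rewrite mem_filter mem_polys_lt; apply: andb_idr => /andP[_ an].
  exact: dvdp_leq.
have uniq_div : uniq (monic_divisors n) by rewrite filter_uniq // uniq_polys_lt.
(* Induction on deg a, with s = [size a] and X separating a from the other divisors of its degree: a
   is bad, so its term in the congruence is N r_a. *)
have main a : a \is monic -> a %| n -> (k %| N%:Z * r a)%Z.
  have [D] := ubnP (size a); elim: D a => // D IH a /ltnSE saD ma an.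
  have [X Xa Xd] := sepn a ma an.
  have sa : (0 < size a)%N by rewrite size_poly_gt0 monic_neq0.
  have [m m0 +] := root_exponents_congruence X (size a) hk hroot.
  rewrite (bigD1_seq a) ?mem_div ?ma ?an //= monic_bad_count_eq //.
  have badE (d : {poly F}) : size d = size a -> bad X (size a) d = ((d *
    X)`_(size a).-1 != 0).
    by move=> sd; rewrite -{1}(prednK sa) bad_top // prednK.
  rewrite badE // Xa mulr1 big_seq_cond; set S := \sum_(_ <- _ | _) _ => h.
  suff kS : (k %| S)%Z by have := rpredB h kS; rewrite addrK.
  apply: rpred_sum => d; rewrite mem_div => /andP[/andP[md dn] da].
  (* Smaller divisors are covered by induction, larger ones have count 0, and those of equal degree
     are not bad by the choice of X. *)
  have [sda|sda|sda] := ltngtP (size d) (size a).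
  - by apply: dvdz_mulr; apply: IH => //; apply: leq_trans saD.
  - by rewrite monic_bad_count_gt // mulr0 dvdz0.
  - by rewrite monic_bad_count_eq // badE // Xd // eqxx mulr0 dvdz0.
split=> [a ma an|gcd1].
  have /dvdzP[m Dm] := main a ma an; exists m.
  have k0 : k%:R != 0 :> rat by rewrite pnatr_eq0 -lt0n.
  have N0' : N%:R != 0 :> rat by rewrite pnatr_eq0 -lt0n.
  apply/eqP; rewrite eqr_div // -[N%:R]/(N%:Z%:~R) -[k%:R]/(k%:Z%:~R) -!intrM.
  by rewrite mulrC Dm.
(* As k divides every N r_a, it divides N times their gcd. *)
have : (k %| N * \big[gcdn/0%N]_(a <- monic_divisors n) `|r a|)%N.
  rewrite big_seq; elim/big_rec: _ => [|a g]; first by rewrite muln0 dvdn0.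
  rewrite mem_div => /andP[ma an] kg; rewrite muln_gcdr dvdn_gcd kg andbT.
  by have := main a ma an; rewrite dvdzE abszM.
by rewrite gcd1 muln1.
Qed.
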